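(* Let $\rho>0$ and consider the Mallows culture on candidates $\{1,2,3,4\}$ with reference ranking $(1,2,3,4)$ and concentration parameter $\rho$, with $n$ independent voters. Let $\boldsymbol\zeta=(e^{-2\rho},e^{-\rho},1)$, $\boldsymbol\tau=(-2\rho,-\rho,0)$, and $\mathcal{S}=\{1,2\}$. Let $M_{33}$ be the bottom-right entry of $\mathcal{H}_K(\boldsymbol\tau)^{-1}$. Then, as $n\to+\infty$, \[ \mathbb{P}(4\text{ is the Condorcet winner})\sim\frac{P(\boldsymbol\zeta)^n}{\prod_{j\in\mathcal{S}}\big((1-\zeta_j)\zeta_j^{\lceil n/2\rceil-1}\big)}\cdot\frac{1}{4\pi n\sqrt{\det(\mathcal{H}_K(\boldsymbol\tau))\,M_{33}}}. \]
   Context: Mallows culture with reference ranking $r_0$ and parameter $\rho$: each voter independently draws ranking $r$ with probability $\gamma e^{-\rho d(r,r_0)}$, $d$ the Kendall tau distance (number of discordant pairs), $\gamma$ normalizing. Candidate $4$ is the Condorcet winner if, for each $j\in\{1,2,3\}$, strictly more than $n/2$ voters rank $4$ above $j$. For $\mathcal{X}\subseteq\{1,2,3\}$, $p_{\mathcal{X}}$ is the probability that the set of candidates ranked above $4$ is exactly $\mathcal{X}$; $P(\mathbf{x})=\sum_{\mathcal{X}}p_{\mathcal{X}}\prod_{j\in\mathcal{X}}x_j$; $K(\mathbf{t})=\log P(e^{t_1},e^{t_2},e^{t_3})$ and $\mathcal{H}_K(\boldsymbol\tau)$ is its Hessian at $\boldsymbol\tau$. *)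

(* Defs.v *)
From HB Require Import structures.
From mathcomp Require Import all_boot all_order all_algebra all_fingroup.
From mathcomp Require Import all_classical all_reals all_analysis.
Set Implicit Arguments. Unset Strict Implicit. Unset Printing Implicit Defensive.
Import Order.TTheory GRing.Theory Num.Theory.
Import numFieldNormedType.Exports.
Local Open Scope ring_scope.

(* Candidates 1,2,3,4 are encoded as 0,1,2,3 : 'I_4.
   A ranking is r : 'S_4 with r c = position of candidate c (0 = top).
   The reference ranking (1,2,3,4) is the identity permutation. *)

Definition kendall (r r' : 'S_4) : nat :=
  #|[set p : 'I_4 * 'I_4 | (p.1 < p.2)%N &&
        ((r p.1 < r p.2)%N != (r' p.1 < r' p.2)%N)]|.

Definition mallows {R : realType} (rho : R) (r0 r : 'S_4) : R :=
  expR (- rho * (kendall r r0)%:R) /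
  \sum_(s : 'S_4) expR (- rho * (kendall s r0)%:R).

Definition cand4 : 'I_4 := ord_max.
Definition cand (j : 'I_3) : 'I_4 := widen_ord (leqnSn 3) j.

Definition above4 (r : 'S_4) : {set 'I_3} :=
  [set j : 'I_3 | (r (cand j) < r cand4)%N].

Definition pX {R : realType} (rho : R) (X : {set 'I_3}) : R :=
  \sum_(r : 'S_4 | above4 r == X) mallows rho 1 r.

Definition Ppoly {R : realType} (rho : R) (x : 'rV[R]_3) : R :=
  \sum_(X : {set 'I_3}) pX rho X * \prod_(j in X) x ord0 j.

Definition Kfun {R : realType} (rho : R) (t : 'rV[R]_3) : R :=
  ln (Ppoly rho (\row_j expR (t ord0 j))).

Definition hessK {R : realType} (rho : R) (tau : 'rV[R]_3) : 'M[R]_3 :=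
  \matrix_(i, j) derive (fun t => derive (Kfun rho) t (delta_mx 0 i)) tau
                        (delta_mx 0 j).

Definition probCW4 {R : realType} (rho : R) (n : nat) : R :=
  \sum_(v : {ffun 'I_n -> 'S_4})
     (\prod_(i : 'I_n) mallows rho 1 (v i)) *
     (([forall j : 'I_3,
         (n < 2 * #|[set i : 'I_n | (v i cand4 < v i (cand j))%N]|)%N ]
        : bool)%:R).

(* Main.v *)
Require Import Defs.
From HB Require Import structures.
From mathcomp Require Import all_boot all_order all_algebra all_fingroup.
From mathcomp Require Import all_classical all_reals all_analysis.
From mathcomp Require Import ring lra zify.
Import Order.TTheory GRing.Theory Num.Theory.
Import numFieldNormedType.Exports.
Local Open Scope ring_scope.

(* With q = e^(-rho) and y = (x1 / q^2, x2 / q, x3), the tilted generating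
   polynomial P(x) / P(zeta) is the two-component mixture
     p (y1 + y2)/2 (1 + y3)/2
       + (1 - p) ((1 - th) + th y3 + y1 y2 (th + (1 - th) y3))/2,
   p = 2q/(1 + 4q + q^2), th = q/(1 + q)^2.
   The number d of voters separating candidates 1 and 2 is Bin(n, p); given d,
   prescribing the two counts n/2 - O(1) forces two independent fair binomials,
   with d and n - d trials, to take values within O(1) of their centre.  Hence
   only central binomial coefficients occur, and Wallis' formula gives the local
   limit after averaging n / sqrt((d + 1)(n - d + 1)), which concentrates at
   1 / sqrt(p (1 - p)).  The count of candidate 3 is then a symmetric variable up
   to O(1), so it stays below n/2 with conditional probability tending to 1/2.
   Summing zeta1^i zeta2^j over the distances i, j of the first two counts from
   their maximal admissible value is a dominated geometric sum. *)

(** * The Wallis integrals and central binomial weights *)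

(** Put x = (q^2 y1, q y2, y3) in P: up to a common factor the empty and the full set get weight 1 +
    q + q^2, and each of the other six sets gets weight q. The tilted law is thus invariant under
    permuting candidates 1, 2, 3 and under complementing the set above 4, which centres every count
    at n/2; sorting the sets by whether they split {1, 2} gives the mixture. Since zeta3 = 1,
    candidate 3 contributes only a factor 1/2 and no geometric sum. The obstacle is parity: the
    first two counts have a sum congruent to d modulo 2, so the conditional probabilities vanish for
    half of the d, and only their average over d converges. The limit constant is the product of 2 /
    pi (two central binomials), 1/2 (candidate 3), 1/2 (parity) and 1 / sqrt(p (1 - p)). On the
    other side, Cramer's rule turns det * M33 into the minor of the Hessian for candidates 1 and 2,
    which is p (1 - p) / 4. *)

Section Wallis.
Variable R : realType.
Implicit Types x : R.

(** The reduction formula for antiderivatives of powers of the sine, normalised to vanish at 0. With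
    it the Wallis recurrence is an evaluation at pi / 2, without integrals. *)
Fixpoint sin_prim (n : nat) x : R :=
  match n with
  | 0 => x
  | 1 => 1 - cos x
  | (n'.+1 as n1).+1 => (n1%:R * sin_prim n' x - sin x ^+ n1 * cos x) / n1.+1%:R
  end.

Lemma sin_primSS n x : sin_prim n.+2 x =
  (n.+1%:R * sin_prim n x - sin x ^+ n.+1 * cos x) / n.+2%:R.
Proof. by []. Qed.

Lemma nat_ind_by2 (P : nat -> Prop) :
  P 0%N -> P 1%N -> (forall n, P n -> P n.+2) -> forall n, P n.
Proof.
move=> P0 P1 PS n; suff: P n /\ P n.+1 by case.
by elim: n => [//|n [Pn PSn]]; split => //; apply: PS.
Qed.

Lemma is_derive_sin_prim n x : is_derive x 1 (sin_prim n) (sin x ^+ n).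
Proof.
elim/nat_ind_by2: n => [||n IH].
- by rewrite expr0; apply: is_derive_id.
- have -> : sin_prim 1 = (fun y => cst 1 y - cos y) by [].
  by apply: is_derive_eq; rewrite sub0r opprK expr1.
- have -> : sin_prim n.+2 = (n.+2%:R^-1 : R) \*:
      (n.+1%:R \*: sin_prim n - sin ^+ n.+1 * cos).
    apply/funext => y; rewrite sin_primSS mulrC /= !fctE. reflexivity.
  apply: is_derive_eq; rewrite !fctE /GRing.scale /=.
  have := cos2Dsin2 x; set c := cos x; set s := sin x => cs.
  have -> : c * (n.+1%:R * s ^+ n * c) = n.+1%:R * s ^+ n * (1 - s ^+ 2) by rewrite -cs; ring.
  rewrite !exprS -natr1.
  have : (n.+1%:R + 1 : R) != 0 by rewrite natr1 pnatr_eq0.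
  by move=> nz; rewrite expr0 mulr1; field.
Qed.

Lemma sin_prim0 n : sin_prim n 0 = 0.
Proof.
elim/nat_ind_by2: n => [//||n IH] /=; first by rewrite cos0 subrr.
by rewrite IH sin0 expr0n /= mul0r mulr0 subrr mul0r.
Qed.

Definition wallis n : R := sin_prim n (pi / 2).

Lemma wallis0 : wallis 0 = pi / 2. Proof. by []. Qed.

Lemma wallis1 : wallis 1 = 1.
Proof. by rewrite /wallis /= cos_pihalf subr0. Qed.

Lemma wallisSS n : n.+2%:R * wallis n.+2 = n.+1%:R * wallis n.
Proof.
rewrite /wallis sin_primSS cos_pihalf mulr0 subr0.
by have : (n.+2%:R : R) != 0; [rewrite pnatr_eq0 | move=> ?; field].
Qed.

(** The difference of the two antiderivatives starts at 0 and has derivative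
    [sin x ^+ n * (1 - sin x)], nonnegative on the quarter period. *)
Lemma wallis_nincr n : wallis n.+1 <= wallis n.
Proof.
have ph0 : 0 < pi / 2 :> R by rewrite divr_gt0 ?pi_gt0.
pose g := sin_prim n - sin_prim n.+1.
have dg x : is_derive x 1 g (sin x ^+ n - sin x ^+ n.+1).
  by apply: is_deriveB; apply: is_derive_sin_prim.
suff : g 0 <= g (pi / 2) by rewrite /g !fctE !sin_prim0 subrr subr_ge0.
apply: (@ger0_derive1_ndecr _ g 0 (pi / 2)) => //.
- move=> x H0; rewrite derive1E derive_val exprS -{1}(mul1r (sin x ^+ n)) -mulrBl.
  have s0 : 0 <= sin x by
    have := H0; rewrite in_itv /= => /sin_gt0_pihalf/ltW.
  by rewrite mulr_ge0 ?subr_ge0 ?sin_le1 ?exprn_ge0.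
- apply: derivable_within_continuous => x _. exact: ex_derive.
- exact: ltW.
Qed.

Lemma wallis_gt0 n : 0 < wallis n.
Proof.
elim/nat_ind_by2: n => [||n IH].
- by rewrite wallis0 divr_gt0 ?pi_gt0.
- by rewrite wallis1.
- by rewrite -(@pmulr_rgt0 _ n.+2%:R) ?ltr0n // wallisSS mulr_gt0 ?ltr0n.
Qed.

(** The recurrence makes this product independent of n. Together with monotonicity it traps the
    square of a Wallis integral between explicit values. *)
Lemma wallisM n : n.+1%:R * (wallis n.+1 * wallis n) = pi / 2.
Proof.
elim: n => [|n IH]; first by rewrite wallis1 wallis0 !mul1r.
by rewrite mulrA wallisSS -mulrA [wallis n * _]mulrC.
Qed.

Lemma wallis_even k : wallis k.*2 = pi / 2 * ('C(k.*2, k)%:R / 2 ^+ k.*2).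
Proof.
elim: k => [|k IH]; first by rewrite double0 wallis0 bin0 expr0 divr1 mulr1.
have e : (k.+1 * 'C(k.+1.*2, k.+1) = 2 * (k.*2.+1 * 'C(k.*2, k)))%N.
  have e1 := mul_bin_diag k.+1.*2 k; have e2 := mul_bin_down k.*2.+1 k.
  rewrite doubleS /= in e1 e2 *; nia.
have {}e : k.+1%:R * 'C(k.+1.*2, k.+1)%:R = 2 * (k.*2.+1%:R * 'C(k.*2, k)%:R) :> R.
  by rewrite -!natrM e.
have k0 : (k.*2.+2%:R : R) != 0 by rewrite pnatr_eq0.
apply: (mulfI k0); rewrite doubleS wallisSS IH.
have -> : k.*2.+2%:R = 2 * k.+1%:R :> R by rewrite -natrM mul2n doubleS.
rewrite -doubleS; have := e; set a := 'C(k.+1.*2, k.+1)%:R => {}e.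
have -> : 2 * k.+1%:R * (pi / 2 * (a / 2 ^+ k.+1.*2)) = pi * (k.+1%:R * a) / 2 ^+ k.+1.*2.
  by field; rewrite ?expf_neq0.
by rewrite e doubleS !exprS; field; rewrite ?expf_neq0.
Qed.
End Wallis.

(** * Fair binomial weights near their centre, with explicit error bounds *)

Section FairBinomial.
Variable R : realType.

Definition fairbin (n k : nat) : R := 'C(n, k)%:R / 2 ^+ n.

Lemma fairbin_ge0 n k : 0 <= fairbin n k.
Proof. by rewrite divr_ge0 ?exprn_ge0. Qed.

Lemma fairbin_small n k : (n < k)%N -> fairbin n k = 0.
Proof. by move=> nk; rewrite /fairbin bin_small // mul0r. Qed.

Lemma fairbin_sub n k : (k <= n)%N -> fairbin n (n - k) = fairbin n k.
Proof. by move=> kn; rewrite /fairbin bin_sub. Qed.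

Lemma fairbinS n k : k.+1%:R * fairbin n k.+1 = (n - k)%:R * fairbin n k.
Proof. by rewrite /fairbin !mulrA -!natrM mul_bin_left. Qed.

(** Pascal's rule and symmetry: a central coefficient of even order is twice the one in the row
    before. This reduces odd n to even n. *)
Lemma fairbin_odd k : fairbin k.*2.+1 k = fairbin k.+1.*2 k.+1.
Proof.
have e : ('C(k.+1.*2, k.+1) = 2 * 'C(k.*2.+1, k))%N.
  rewrite doubleS binS mulSn mul1n; congr addn.
  by rewrite -[LHS]bin_sub; [congr 'C(_, _)|]; lia.
by rewrite /fairbin e natrM doubleS [in RHS]exprS; field; rewrite expf_neq0.
Qed.

Lemma fairbin_evenE k : fairbin k.*2 k = 2 / pi * wallis R k.*2.
Proof.
rewrite wallis_even -/(fairbin _ _).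
by have := lt0r_neq0 (pi_gt0 R); move: (pi : R) => P p0; field.
Qed.

Lemma fairbin_even_step k :
  k.*2.+2%:R * fairbin k.+1.*2 k.+1 = k.*2.+1%:R * fairbin k.*2 k.
Proof. by rewrite !fairbin_evenE doubleS mulrCA wallisSS mulrCA. Qed.

(** Consecutive values have ratio (2k + 1)(2k + 3) / (2k + 2)^2, which is below 1. *)
Lemma fairbin_even_sqr_le1 k : k.*2.+1%:R * fairbin k.*2 k ^+ 2 <= 1.
Proof.
elim: k => [|k IH]; first by rewrite /fairbin bin0 expr0 divr1 expr1n mulr1.
apply: le_trans IH; rewrite -(@ler_pM2l _ (k.*2.+2%:R ^+ 2)) ?exprn_gt0 //.
have -> : k.*2.+2%:R ^+ 2 * (k.+1.*2.+1%:R * fairbin k.+1.*2 k.+1 ^+ 2)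
   = k.+1.*2.+1%:R * (k.*2.+2%:R * fairbin k.+1.*2 k.+1) ^+ 2 by ring.
rewrite fairbin_even_step exprMn mulrA [leRHS]mulrA ler_wpM2r ?sqr_ge0 //.
have -> : k.+1.*2.+1%:R = k.*2.+1%:R + 2 :> R by rewrite doubleS -natrD; congr _%:R; lia.
rewrite -[k.*2.+2%:R]natr1.
have := ler0n R k.*2.+1. by move: k.*2.+1%:R => a a0; nra.
Qed.

(** In the square of the Wallis integral of order 2k, one factor is replaced by the smaller integral
    of order 2k + 1 and [wallisM] applies; the larger one of order 2k - 1 gives the upper bound
    below. *)
Lemma fairbin_even_lower k : 2 / pi <= k.*2.+1%:R * fairbin k.*2 k ^+ 2.
Proof.
have p0 := pi_gt0 R; rewrite fairbin_evenE.
have -> : k.*2.+1%:R * (2 / pi * wallis R k.*2) ^+ 2 =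
  (2 / pi) * ((2 / pi) * (k.*2.+1%:R * (wallis R k.*2 * wallis R k.*2))) by ring.
rewrite ler_pMr ?divr_gt0 //.
have E : 1 = (2 / pi) * (pi / 2) :> R by move: (pi : R) p0 => P p0; field; rewrite lt0r_neq0.
rewrite [leLHS]E ler_pM2l ?divr_gt0 // -(wallisM _ k.*2) ler_pM2l ?ltr0n //.
by rewrite ler_pM2r ?wallis_gt0 // wallis_nincr.
Qed.

Lemma fairbin_even_upper k : k.*2%:R * fairbin k.*2 k ^+ 2 <= 2 / pi.
Proof.
have p0 := pi_gt0 R; case: k => [|k]; first by rewrite mul0r divr_ge0 // ltW.
rewrite fairbin_evenE.
have -> : k.+1.*2%:R * (2 / pi * wallis R k.+1.*2) ^+ 2 =
  (2 / pi) * ((2 / pi) * (k.+1.*2%:R * (wallis R k.+1.*2 * wallis R k.+1.*2))) by ring.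
rewrite ger_pMr ?divr_gt0 //.
have E : 1 = (2 / pi) * (pi / 2) :> R by move: (pi : R) p0 => P p0; field; rewrite lt0r_neq0.
rewrite [leRHS]E ler_pM2l ?divr_gt0 // -(wallisM _ k.*2.+1) doubleS ler_pM2l ?ltr0n //.
by rewrite ler_pM2l ?wallis_gt0 // wallis_nincr.
Qed.

Lemma fairbin_mid n : [/\ n.+1%:R * fairbin n n./2 ^+ 2 <= 1,
  2 / pi <= n.+2%:R * fairbin n n./2 ^+ 2 & n%:R * fairbin n n./2 ^+ 2 <= 2 / pi].
Proof.
have s0 m : 0 <= fairbin m.*2 m ^+ 2 by rewrite sqr_ge0.
have sS (m : nat) x : 0 <= x -> m%:R * x <= m.+1%:R * x :> R.
  by move=> x0; rewrite ler_wpM2r // ler_nat.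
have [k [->|->]] : exists k, n = k.*2 \/ n = k.*2.+1.
- by exists n./2; lia.
- rewrite doubleK; split; [exact: fairbin_even_sqr_le1 | | exact: fairbin_even_upper].
  by rewrite (le_trans (fairbin_even_lower k)) // sS.
- have -> : k.*2.+1./2 = k by lia.
  rewrite fairbin_odd; split.
  + by apply: le_trans (fairbin_even_sqr_le1 k.+1); rewrite -!doubleS sS.
  + by rewrite (le_trans (fairbin_even_lower k.+1)) // -!doubleS.
  + by apply: le_trans (fairbin_even_upper k.+1); rewrite doubleS sS // sqr_ge0.
Qed.

Lemma fairbin_le_mid n k : fairbin n k <= fairbin n n./2.
Proof.
have incr d j : (j + d = n./2)%N -> fairbin n j <= fairbin n n./2.
  elim: d j => [|d IH] j; first by rewrite addn0 => ->.
  move=> e; apply: le_trans (IH j.+1 _); last by rewrite addSnnS.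
  rewrite -(@ler_pM2l _ j.+1%:R) ?ltr0n // fairbinS ler_wpM2r ?fairbin_ge0 //.
  by rewrite ler_nat; lia.
case: (leqP k n./2) => [kh|kh]; first by apply: (incr (n./2 - k)%N); rewrite subnKC.
case: (leqP k n) => [kn|kn]; last by rewrite fairbin_small ?fairbin_ge0.
rewrite -fairbin_sub //; apply: (incr (n./2 - (n - k))%N); rewrite subnKC //; lia.
Qed.

(** Normalising with n + 1 rather than n keeps all values in [0, 1], also at n = 0. *)
Definition nfairbin n k : R := Num.sqrt n.+1%:R * fairbin n k.

Lemma nfairbin_ge0 n k : 0 <= nfairbin n k.
Proof. by rewrite mulr_ge0 ?sqrtr_ge0 ?fairbin_ge0. Qed.

Lemma nfairbin_le1 n k : nfairbin n k <= 1.
Proof.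
apply: (@le_trans _ _ (nfairbin n n./2)).
  by rewrite ler_wpM2l ?sqrtr_ge0 // fairbin_le_mid.
rewrite -(@ler_pXn2r _ 2) ?nnegrE ?nfairbin_ge0 // expr1n exprMn sqr_sqrtr //.
by case: (fairbin_mid n).
Qed.

Definition mid_const : R := Num.sqrt (2 / pi).

Lemma mid_const_sqr : mid_const ^+ 2 = 2 / pi.
Proof. by rewrite sqr_sqrtr // divr_ge0 // ltW // pi_gt0. Qed.

Lemma mid_const_itv : 1 / 2 <= mid_const <= 1.
Proof.
have p0 := pi_gt0 R; have p2 := pi_ge2 R; have p4 := pihalf_lt2 R.
have h : 2 / pi * pi = 2 :> R by move: (pi : R) p0 => P p0; field; rewrite lt0r_neq0.
apply/andP; split; rewrite -(@ler_pXn2r _ 2) ?nnegrE ?sqrtr_ge0 // mid_const_sqr.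
  by rewrite ler_pdivlMr //; lra.
by rewrite ler_pdivrMr //; lra.
Qed.

(** By [fairbin_mid] the squares differ by at most 1 / (n + 1); dividing by the sum of the two
    numbers, which is at least 1/2, gives the factor 2. *)
Lemma nfairbin_mid_cvg n : `|nfairbin n n./2 - mid_const| <= 2 / n.+1%:R.
Proof.
have [b1 b2 b3] := fairbin_mid n; have /andP[s1 s2] := mid_const_itv.
have n0 : 0 < n.+1%:R :> R by rewrite ltr0n.
set u := nfairbin _ _; have u0 : 0 <= u := nfairbin_ge0 _ _.
have u2 : u ^+ 2 = n.+1%:R * fairbin n n./2 ^+ 2 by rewrite exprMn sqr_sqrtr.
move: b1 b2 b3; set f := fairbin n n./2 ^+ 2 in u2 *.
have e2 : n.+2%:R = n.+1%:R + 1 :> R by rewrite natr1.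
have e0 : n%:R = n.+1%:R - 1 :> R by rewrite -natr1 addrK.
rewrite -mid_const_sqr e2 e0 => b1 b2 b3.
have {b1} b1 : f <= 1 / n.+1%:R by rewrite ler_pdivlMr // mulrC.
have h : `|u - mid_const| * (u + mid_const) <= 1 / n.+1%:R.
  rewrite -[X in _ * X]ger0_norm ?addr_ge0 ?sqrtr_ge0 // -normrM -subr_sqr.
  by apply: le_trans b1; rewrite ler_norml u2; apply/andP; split; lra.
have a0 := normr_ge0 (u - mid_const).
have : `|u - mid_const| * (1 / 2) <= `|u - mid_const| * (u + mid_const).
  by rewrite ler_wpM2l //; lra.
move: h; rewrite div1r; move: (_ * (u + _)) (n.+1%:R^-1) => v w h1 h2; lra.
Qed.

(** One step towards the centre changes the weight by the relative amount |2k + 1 - n| / (k + 1), of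
    order d / k; d steps are summed. *)
Lemma nfairbin_off_mid n d k : (k + d = n./2)%N ->
  `|nfairbin n k - nfairbin n n./2| <= 2 * d%:R ^+ 2 / k.+1%:R.
Proof.
elim: d k => [|d IH] k e.
  by rewrite addn0 in e; rewrite e subrr normr0 expr0n mulr0 mul0r.
have {}IH := IH k.+1 _; rewrite addSnnS in IH; have {}IH := IH e.
have k0 : 0 < k.+1%:R :> R by rewrite ltr0n.
rewrite -(subrKA (nfairbin n k.+1)) (le_trans (ler_normD _ _)) //.
have h1 : `|nfairbin n k - nfairbin n k.+1| <= 2 * d.+1%:R / k.+1%:R.
  rewrite ler_pdivlMr // -[k.+1%:R in leLHS]ger0_norm ?(ltW k0) // -normrM.
  have -> : (nfairbin n k - nfairbin n k.+1) * k.+1%:R =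
     (k.+1%:R - (n - k)%:R) * nfairbin n k.
    by have := fairbinS n k; rewrite /nfairbin => e1; rewrite mulrBl -mulrA -[X in _ - X]mulrA [fairbin n k.+1 * _]mulrC e1; ring.
  rewrite normrM (ger0_norm (nfairbin_ge0 _ _)); apply: (le_trans (ler_piMr _ (nfairbin_le1 _ _))) => //.
  by rewrite -natrM distrC -natrB ?normr_nat ?ler_nat; lia.
apply: (@le_trans _ _ (2 * d.+1%:R / k.+1%:R + 2 * d%:R ^+ 2 / k.+1%:R)).
  apply: lerD => //; apply: (le_trans IH); rewrite ler_wpM2l ?mulr_ge0 ?sqr_ge0 //.
  by rewrite lef_pV2 ?posrE ?ltr0n // ler_nat.
rewrite -mulrDl ler_wpM2r ?invr_ge0 ?(ltW k0) //.
by rewrite -natr1; have := ler0n R d; nra.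
Qed.

Lemma nfairbin_cvg c n k : (2 * k <= n + c)%N -> (n <= 2 * k + c)%N ->
  `|nfairbin n k - mid_const| <= (8 * c%:R ^+ 2 + 2 * c%:R + 2) / n.+1%:R.
Proof.
have n0 : 0 < n.+1%:R :> R by rewrite ltr0n.
have /andP[s1 s2] := mid_const_itv.
wlog kn : k / (k <= n./2)%N => [W|] h1 h2.
  case: (leqP k n./2) => [/W|kh]; first exact.
  case: (leqP k n) => [kn|kn].
    have -> : nfairbin n k = nfairbin n (n - k) by rewrite /nfairbin fairbin_sub.
    by apply: W; lia.
  rewrite /nfairbin fairbin_small // mulr0 sub0r normrN ger0_norm ?sqrtr_ge0 //.
  rewrite (le_trans s2) // ler_pdivlMr // mul1r.
  have : n.+1%:R <= c%:R :> R by rewrite ler_nat; lia.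
  have := sqr_ge0 (c%:R : R); have := ler0n R c; lra.
have c0 := ler0n R c; have c20 := sqr_ge0 (c%:R : R).
(* For n < 2c the right-hand side is at least 1 and the claim is trivial; otherwise k + 1 >= (n + 1)
   / 4, which makes [nfairbin_off_mid] effective. *)
case: (leqP (2 * c) n) => nc; last first.
  apply: (@le_trans _ _ 1).
    have := nfairbin_ge0 n k; have := nfairbin_le1 n k.
    by rewrite ler_norml => ? ?; apply/andP; split; lra.
  rewrite ler_pdivlMr // mul1r.
  have : n.+1%:R <= 2 * c%:R :> R by rewrite -natrM ler_nat; lia.
  by lra.
rewrite -(subrKA (nfairbin n n./2)) (le_trans (ler_normD _ _)) //.
rewrite -addrA mulrDl.
have h3 := @nfairbin_off_mid n (n./2 - k) k (subnKC kn).
have h4 : (2 * (n./2 - k)%:R ^+ 2) / k.+1%:R <= 8 * c%:R ^+ 2 / n.+1%:R :> R.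
  rewrite ler_pdivrMr ?ltr0n // mulrAC ler_pdivlMr //.
  apply: (@le_trans _ _ (2 * c%:R ^+ 2 * (4 * k.+1%:R))); last by lra.
  have dc : (n./2 - k)%:R <= c%:R :> R by rewrite ler_nat; lia.
  have : n.+1%:R <= 4 * k.+1%:R :> R by rewrite -natrM ler_nat; lia.
  move=> h; apply: ler_pM; rewrite ?mulr_ge0 ?sqr_ge0 //.
  by rewrite ler_pM2l // ler_pXn2r ?nnegrE.
have h5 := nfairbin_mid_cvg n.
have : 2 / n.+1%:R <= (2 * c%:R + 2) / n.+1%:R :> R.
  by rewrite ler_pM2r ?invr_gt0 //; lra.
by move=> h6; rewrite lerD // ?(le_trans h3 h4) ?(le_trans h5 h6).
Qed.

End FairBinomial.

(** * Expectations under a binomial law *)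

Section BinomialExpectation.
Variable R : realType.
Implicit Types (p : R) (f g : nat -> R).

Definition binE p n f : R :=
  \sum_(d < n.+1) 'C(n, d)%:R * p ^+ d * (1 - p) ^+ (n - d) * f d.

Lemma binE_ext p n f g : (forall d, (d <= n)%N -> f d = g d) ->
  binE p n f = binE p n g.
Proof. by move=> fg; apply: eq_bigr => d _; rewrite fg // -ltnS. Qed.

Lemma binED p n f g : binE p n (fun d => f d + g d) = binE p n f + binE p n g.
Proof. by rewrite -big_split; apply: eq_bigr => d _; rewrite mulrDr. Qed.

Lemma binEZ p n c f : binE p n (fun d => c * f d) = c * binE p n f.
Proof. by rewrite mulr_sumr; apply: eq_bigr => d _; rewrite mulrCA. Qed.

Lemma binE_exp p n t : binE p n (fun d => t ^+ d) = (1 - p + p * t) ^+ n.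
Proof.
rewrite exprDn; apply: eq_bigr => d _.
by rewrite exprMn -mulr_natl; ring.
Qed.

Lemma binE_cst p n c : binE p n (fun=> c) = c.
Proof.
have /= := binEZ p n c (fun=> 1); under binE_ext do rewrite mulr1.
move=> ->; have := binE_exp p n 1; under binE_ext do rewrite expr1n.
by move=> ->; rewrite mulr1 subrK expr1n mulr1.
Qed.

Lemma binE_rev p n f : binE p n f = binE (1 - p) n (fun d => f (n - d)%N).
Proof.
rewrite /binE (reindex_inj rev_ord_inj) /=; apply: eq_bigr => d _.
have dn : (d <= n)%N by rewrite -ltnS.
by rewrite subSS bin_sub // subKn // subKr; ring.
Qed.

(** Absorption, (d + 1) C(n + 1, d + 1) = (n + 1) C(n, d), trades a weight 1 / (d + 1) for one more
    trial. All inverse moments below rest on it. *)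
Lemma binE_shift p n g :
  p * n.+1%:R * binE p n (fun d => g d.+1 / d.+1%:R) =
  binE p n.+1 g - (1 - p) ^+ n.+1 * g 0%N.
Proof.
rewrite /binE [in RHS]big_ord_recl /= bin0 expr0 subn0 !mul1r [RHS]addrAC subrr add0r.
rewrite mulr_sumr; apply: eq_bigr => d _; rewrite /bump /= add1n subSS exprS.
have /(congr1 (fun k => k%:R : R)) := mul_bin_diag n.+1 d.
rewrite /= !natrM; set C := 'C(n, d)%:R; set C' := 'C(n.+1, _)%:R => e.
have d0 : (d.+1%:R : R) != 0 by rewrite pnatr_eq0.
transitivity ((n.+1%:R * C) * (p * p ^+ d * (1 - p) ^+ (n - d) * g d.+1) / d.+1%:R); first by ring.
by rewrite e; field.
Qed.

Section Mono.
Variables (p : R) (n : nat).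
Hypothesis p01 : 0 <= p <= 1.

Lemma binE_le f g : (forall d, (d <= n)%N -> f d <= g d) -> binE p n f <= binE p n g.
Proof.
case/andP: p01 => p0 p1 fg; apply: ler_sum => d _.
by rewrite ler_wpM2l ?mulr_ge0 ?exprn_ge0 ?subr_ge0 // fg // -ltnS.
Qed.

Lemma binE_ge0 f : (forall d, (d <= n)%N -> 0 <= f d) -> 0 <= binE p n f.
Proof. by move=> f0; rewrite -(binE_cst p n 0) binE_le. Qed.

Lemma ler_norm_binE f : `|binE p n f| <= binE p n (fun d => `|f d|).
Proof.
case/andP: p01 => p0 p1; apply: le_trans (ler_norm_sum _ _ _) _.
apply: ler_sum => d _; rewrite normrM (@ger0_norm _ (_ * _)) //.
by rewrite ?mulr_ge0 ?exprn_ge0 ?subr_ge0.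
Qed.

(** Cauchy-Schwarz in the linearised form |f| <= f^2 / (2s) + s / 2 with s^2 = v. *)
Lemma binE_norm_le_sqrt f v : 0 < v -> binE p n (fun d => f d ^+ 2) <= v ->
  binE p n (fun d => `|f d|) <= Num.sqrt v.
Proof.
move=> v0 fv; set s := Num.sqrt v; have s0 : 0 < s by rewrite sqrtr_gt0.
have sv : s ^+ 2 = v by rewrite sqr_sqrtr // ltW.
apply: (@le_trans _ _ (binE p n (fun d => (2 * s)^-1 * (f d ^+ 2) + s / 2))).
  apply: binE_le => d _; rewrite -real_normK ?num_real //.
  rewrite -(@ler_pM2l _ (2 * s)) ?mulr_gt0 // mulrDr mulVKf ?lt0r_neq0 ?mulr_gt0 //.
  have := sqr_ge0 (`|f d| - s).
  have -> : 2 * s * (s / 2) = s ^+ 2 by field.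
  by rewrite sqrrB; lra.
rewrite binED binEZ binE_cst.
rewrite -(@ler_pM2l _ (2 * s)) ?mulr_gt0 // mulrDr mulVKf ?lt0r_neq0 ?mulr_gt0 //.
have -> : 2 * s * (s / 2) = s ^+ 2 by field.
by rewrite -mulrA -expr2 sv; lra.
Qed.
End Mono.

Section Bounds.
Variable p : R.
Hypothesis p01 : 0 < p < 1.

Let p01W : 0 <= p <= 1. Proof. by case/andP: p01 => ? ?; rewrite !ltW. Qed.
Let p_gt0 : 0 < p. Proof. by case/andP: p01. Qed.

Lemma binE_shift_le n g : (forall d, 0 <= g d) ->
  binE p n (fun d => g d.+1 / d.+1%:R) <= binE p n.+1 g / (p * n.+1%:R).
Proof.
move=> g0; rewrite ler_pdivlMr ?mulr_gt0 // mulrC binE_shift gerBl.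
by rewrite mulr_ge0 ?exprn_ge0 // subr_ge0 ltW //; case/andP: p01.
Qed.

Lemma binE_inv n : binE p n (fun d => d.+1%:R^-1) <= (p * n.+1%:R)^-1.
Proof.
have := @binE_shift_le n (fun=> 1) (fun=> ler01).
by rewrite binE_cst div1r; under binE_ext do rewrite div1r.
Qed.

Lemma binE_id n : binE p n (fun d => d%:R) = n%:R * p.
Proof.
case: n => [|n]; first by rewrite /binE big_ord1 mulr0 mul0r.
have := binE_shift p n (fun d => d%:R); rewrite mulr0 subr0 => <-.
rewrite (@binE_ext _ _ _ (fun=> 1)) ?binE_cst ?mulr1 1?mulrC // => d _.
by rewrite divff ?pnatr_eq0.
Qed.
End Bounds.

(** * Concentration of the inverse geometric mean of d + 1 and n - d + 1 *)

Section Concentration.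
Variable p : R.
Hypothesis p01 : 0 < p < 1.

Let p_gt0 : 0 < p. Proof. by case/andP: p01. Qed.
Let p_lt1 : 0 < 1 - p. Proof. by rewrite subr_gt0; case/andP: p01. Qed.
Let p01W : 0 <= p <= 1. Proof. by case/andP: p01 => ? ?; rewrite !ltW. Qed.
Let q01 : 0 < 1 - p < 1. Proof. by rewrite p_lt1 gtrBl. Qed.

Definition bin_sd := Num.sqrt (p * (1 - p)).

Lemma bin_sd_gt0 : 0 < bin_sd. Proof. by rewrite sqrtr_gt0 mulr_gt0. Qed.

Lemma bin_sd_sqr : bin_sd ^+ 2 = p * (1 - p).
Proof. by rewrite sqr_sqrtr // ltW // mulr_gt0. Qed.

Lemma binE_inv_rev n : binE p n (fun d => (n - d).+1%:R^-1) <= ((1 - p) * n.+1%:R)^-1.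
Proof.
rewrite binE_rev; have := binE_inv _ q01 n; congr (_ <= _).
by apply: binE_ext => d dn; rewrite subKn.
Qed.

(** Absorption is used twice, once for d and once, after reversal, for n - d. *)
Lemma binE_inv_mul n : binE p n (fun d => (d.+1%:R * (n - d).+1%:R)^-1) <=
  (bin_sd ^+ 2 * (n.+1%:R * n.+2%:R))^-1.
Proof.
have := @binE_shift_le p p01 n (fun d => (n.+1 - d).+1%:R^-1).
rewrite (@binE_ext _ _ _ (fun d => (d.+1%:R * (n - d).+1%:R)^-1)); last first.
  by move=> d _; rewrite subSS invfM mulrC.
move=> h; apply: le_trans (h _) _; first by move=> d; rewrite invr_ge0.
rewrite bin_sd_sqr; have := binE_inv_rev n.+1.
rewrite -(ler_pM2r (_ : 0 < (p * n.+1%:R)^-1)) ?invr_gt0 ?mulr_gt0 //.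
by rewrite -invfM; congr (_ <= _^-1); ring.
Qed.

(** Weighted arithmetic-geometric mean: 2 sqrt(p (1 - p) x y) <= (1 - p) x + p y. The right side is
    affine in d, with mean 2 n p (1 - p) + 1. *)
Lemma binE_sqrt_mul n :
  binE p n (fun d => Num.sqrt (d.+1%:R * (n - d).+1%:R)) <= n%:R * bin_sd + (2 * bin_sd)^-1.
Proof.
have s0 := bin_sd_gt0; have s2 := bin_sd_sqr.
apply: (@le_trans _ _ (binE p n (fun d => (2 * bin_sd)^-1 *
    (((1 - 2 * p) * d%:R) + (1 + p * n%:R))))).
  apply: binE_le => // d dn.
  rewrite -(@ler_pM2l _ (2 * bin_sd)) ?mulr_gt0 // mulVKf ?lt0r_neq0 ?mulr_gt0 //.
  have -> : d.+1%:R = d%:R + 1 :> R by rewrite natr1.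
  have -> : (n - d).+1%:R = n%:R - d%:R + 1 :> R by rewrite -natr1 natrB.
  have x0 : 0 < d%:R + 1 :> R by rewrite natr1.
  have y0 : 0 < n%:R - d%:R + 1 :> R by rewrite -natrB // natr1.
  move: (d%:R) (n%:R : R) x0 y0 => x y x0 y0.
  rewrite -(@ler_pXn2r _ 2) ?nnegrE ?mulr_ge0 ?sqrtr_ge0 ?(ltW s0) //; last first.
  - have : 0 < (1 - p) * (x + 1) + p * (y - x + 1) by rewrite addr_gt0 ?mulr_gt0.
    by lra.
  rewrite !exprMn s2 sqr_sqrtr; last by rewrite mulr_ge0 ?ltW.
  have := sqr_ge0 ((1 - p) * (x + 1) - p * (y - x + 1)).
  by lra.
rewrite binEZ binED binEZ binE_cst binE_id //.
rewrite -(@ler_pM2l _ (2 * bin_sd)) ?mulr_gt0 // mulVKf ?lt0r_neq0 ?mulr_gt0 //.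
rewrite mulrDr divff ?lt0r_neq0 ?mulr_gt0 //.
have -> : 2 * bin_sd * (n%:R * bin_sd) = 2 * n%:R * bin_sd ^+ 2 by ring.
by rewrite s2; lra.
Qed.

Definition invgm n d : R := n%:R / Num.sqrt (d.+1%:R * (n - d).+1%:R).

Lemma invgm_gt0 n d : (0 < n)%N -> 0 < invgm n d.
Proof. by move=> n0; rewrite divr_gt0 ?ltr0n // sqrtr_gt0 mulr_gt0. Qed.

Lemma binE_invgm_sqr n : binE p n (fun d => invgm n d ^+ 2) <= (bin_sd ^+ 2)^-1.
Proof.
have s0 := bin_sd_gt0.
rewrite (@binE_ext _ _ _ (fun d => n%:R ^+ 2 * (d.+1%:R * (n - d).+1%:R)^-1)); last first.
  by move=> d _; rewrite exprMn exprVn sqr_sqrtr // mulr_ge0.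
rewrite binEZ; apply: le_trans (ler_wpM2l _ (binE_inv_mul n)) _; first exact: sqr_ge0.
rewrite invfM mulrCA ler_piMr ?invr_ge0 ?sqr_ge0 //.
by rewrite ler_pdivrMr ?mulr_gt0 // mul1r expr2 ler_pM ?ler_nat //; lia.
Qed.

Lemma binE_invgm_lower n : (0 < n)%N ->
  bin_sd^-1 - (2 * bin_sd ^+ 3 * n%:R)^-1 <= binE p n (invgm n).
Proof.
move=> n0; have s0 := bin_sd_gt0; have N0 : 0 < n%:R :> R by rewrite ltr0n.
have b0 := lt0r_neq0 s0; have M0 := lt0r_neq0 N0.
(* tangent line at n * bin_sd of the convex function 1/s *)
apply: (@le_trans _ _ (binE p n (fun d => 2 / bin_sd +
    - (bin_sd ^+ 2 * n%:R)^-1 * Num.sqrt (d.+1%:R * (n - d).+1%:R)))); last first.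
  apply: binE_le => // d _; rewrite /invgm; set s := Num.sqrt _.
  have ss : 0 < s by rewrite sqrtr_gt0 mulr_gt0.
  rewrite -subr_ge0.
  have -> : n%:R / s - (2 / bin_sd + - (bin_sd ^+ 2 * n%:R)^-1 * s) =
     (n%:R * bin_sd - s) ^+ 2 / (s * bin_sd ^+ 2 * n%:R).
    by field; rewrite M0 b0 lt0r_neq0.
  by rewrite divr_ge0 ?sqr_ge0 // !mulr_ge0 ?sqr_ge0 ?ltW.
rewrite binED binE_cst binEZ mulNr.
have c0 : 0 <= (bin_sd ^+ 2 * n%:R)^-1 by rewrite invr_ge0 mulr_ge0 ?sqr_ge0 ?ltW.
have := ler_wpM2l c0 (binE_sqrt_mul n).
have -> : (bin_sd ^+ 2 * n%:R)^-1 * (n%:R * bin_sd + (2 * bin_sd)^-1) =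
  bin_sd^-1 + (2 * bin_sd ^+ 3 * n%:R)^-1 by field; rewrite M0 b0.
move: (_^-1 * binE _ _ _) ((2 * bin_sd ^+ 3 * n%:R)^-1) (bin_sd^-1) => x z y.
by lra.
Qed.

(** In the expanded square, an upper bound on the second moment and a lower bound on the mean
    suffice; their leading terms cancel. *)
Lemma binE_invgm_var n : (0 < n)%N ->
  binE p n (fun d => (invgm n d - bin_sd^-1) ^+ 2) <= (bin_sd ^+ 4 * n%:R)^-1.
Proof.
move=> n0; have s0 := bin_sd_gt0; have N0 : 0 < n%:R :> R by rewrite ltr0n.
have b0 := lt0r_neq0 s0; have M0 := lt0r_neq0 N0.
rewrite (@binE_ext _ _ _ (fun d => (invgm n d ^+ 2 + bin_sd ^- 2) + (- 2 / bin_sd) * invgm n d)); last first.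
  by move=> d _; field.
rewrite !binED binE_cst binEZ.
have h1 := binE_invgm_sqr n.
have c0 : 0 <= 2 / bin_sd by rewrite divr_ge0 ?ltW.
have := ler_wpM2l c0 (binE_invgm_lower n n0).
have -> : 2 / bin_sd * (bin_sd^-1 - (2 * bin_sd ^+ 3 * n%:R)^-1) =
  2 * bin_sd ^- 2 - (bin_sd ^+ 4 * n%:R)^-1 by field; rewrite M0 b0.
rewrite [- 2 / bin_sd]mulNr [- _ * _]mulNr.
move: h1; move: (bin_sd ^- 2) (_ * binE _ _ _) (binE _ _ _) (_^-1) => a b c d; lra.
Qed.

Lemma binE_invgm_dist n : (0 < n)%N ->
  binE p n (fun d => `|invgm n d - bin_sd^-1|) <= Num.sqrt (bin_sd ^+ 4 * n%:R)^-1.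
Proof.
move=> n0; apply: binE_norm_le_sqrt => //; last exact: binE_invgm_var.
by rewrite invr_gt0 mulr_gt0 ?exprn_gt0 ?bin_sd_gt0 ?ltr0n.
Qed.

Lemma binE_sqrt_inv n :
  binE p n (fun d => Num.sqrt d.+1%:R^-1) <= Num.sqrt (p * n.+1%:R)^-1.
Proof.
rewrite (@binE_ext _ _ _ (fun d => `|Num.sqrt d.+1%:R^-1|)); last first.
  by move=> d _; rewrite ger0_norm ?sqrtr_ge0.
apply: binE_norm_le_sqrt => //; first by rewrite invr_gt0 mulr_gt0.
apply: le_trans (binE_inv p p01 n); apply: binE_le => // d _.
by rewrite sqr_sqrtr ?invr_ge0.
Qed.

Lemma binE_sqrt_inv_rev n :
  binE p n (fun d => Num.sqrt (n - d).+1%:R^-1) <= Num.sqrt ((1 - p) * n.+1%:R)^-1.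
Proof.
rewrite (@binE_ext _ _ _ (fun d => `|Num.sqrt (n - d).+1%:R^-1|)); last first.
  by move=> d _; rewrite ger0_norm ?sqrtr_ge0.
apply: binE_norm_le_sqrt => //; first by rewrite invr_gt0 mulr_gt0.
apply: le_trans (binE_inv_rev n); apply: binE_le => // d _.
by rewrite sqr_sqrtr ?invr_ge0.
Qed.
End Concentration.
End BinomialExpectation.

(** * Partial sums of coefficients of palindromic polynomials *)

Section PartialSums.
Variable R : realType.
Implicit Types p s u : {poly R}.

(** For a probability generating polynomial, the probability of a value below t. *)
Definition psum t p : R := \sum_(k < t) p`_k.

Definition nnegp p := forall k, 0 <= p`_k.

Lemma nnegpM p s : nnegp p -> nnegp s -> nnegp (p * s).
Proof. by move=> p0 s0 k; rewrite coefM sumr_ge0 // => i _; rewrite mulr_ge0. Qed.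

Lemma nnegpX p n : nnegp p -> nnegp (p ^+ n).
Proof.
move=> p0; elim: n => [k|n IH]; first by rewrite expr0 coef1.
by rewrite exprS; apply: nnegpM.
Qed.

Lemma psum_horner t p : (size p <= t)%N -> psum t p = p.[1].
Proof.
move=> pt; rewrite (horner_coef_wide _ pt); apply: eq_bigr => i _.
by rewrite expr1n mulr1.
Qed.

Lemma psum_ge0 t p : nnegp p -> 0 <= psum t p.
Proof. by move=> p0; apply: sumr_ge0 => i _. Qed.

Lemma psum_le_horner t p : nnegp p -> psum t p <= p.[1].
Proof.
move=> p0; rewrite -(@psum_horner (t + size p)) ?leq_addl //.
by rewrite /psum big_split_ord /= lerDl sumr_ge0.
Qed.

Lemma psum_dist t c p eta : (forall k, `|p`_k| <= eta) ->
  `|psum (t + c) p - psum t p| <= c%:R * eta.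
Proof.
move=> pe; rewrite /psum big_split_ord /= addrAC subrr add0r.
apply: le_trans (ler_norm_sum _ _ _) _.
apply: le_trans (ler_sum _ (fun i _ => pe _)) _.
by rewrite sumr_const card_ord mulr_natl.
Qed.

(** Symmetry about N / 2, with N a nominal degree: end coefficients may vanish, and degrees add
    under products. *)
Definition palin N p := (size p <= N.+1)%N /\ forall k, (k <= N)%N -> p`_k = p`_(N - k).

Lemma palinM M N p s : palin M p -> palin N s -> palin (M + N) (p * s).
Proof.
move=> [zp pp] [zs ps].
have sz : (size (p * s)%R <= (M + N).+1)%N by apply: leq_trans (size_polyMleq _ _) _; lia.
(* The range of j no longer depends on i, so the reversal of j can match the two coefficients. *)
have cf i : (p * s)`_i = \sum_(j < M.+1 | (j <= i)%N) p`_j * s`_(i - j).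
  rewrite coefM; have h : (i.+1 <= i.+1 + M.+1)%N by rewrite leq_addr.
  have h' : (M.+1 <= i.+1 + M.+1)%N by rewrite leq_addl.
  rewrite (big_ord_widen _ (fun j => p`_j * s`_(i - j)) h).
  rewrite (big_ord_widen_cond _ (fun j => (j <= i)%N) (fun j => p`_j * s`_(i - j)) h').
  rewrite [LHS](bigID (fun j : 'I__ => (j < M.+1)%N)) /= [X in _ + X]big1 ?addr0.
    by apply: eq_bigl => j; rewrite ltnS.
  by move=> j /andP[_ jM]; rewrite nth_default ?mul0r // (leq_trans zp) // leqNgt.
split => // i iMN; rewrite !cf [RHS](reindex_inj rev_ord_inj) /=.
rewrite [LHS]big_mkcond [RHS]big_mkcond; apply: eq_bigr => j _.
have jM : (j <= M)%N by rewrite -ltnS.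
rewrite subSS; case: (leqP j i) => ji; case: (leqP (M - j) (M + N - i)) => ji' //.
- rewrite pp //; congr (_ * _); case: (leqP (i - j) N) => ijN.
    by rewrite ps //; congr (s`_ _); lia.
  by lia.
- by rewrite [s`_(i - j)]nth_default ?mulr0 // (leq_trans zs) //; lia.
- by rewrite [s`_(_ - _ - _)]nth_default ?mulr0 // (leq_trans zs) //; lia.
Qed.

Lemma palin1 : palin 0 1.
Proof. by split; [rewrite size_poly1 | case]. Qed.

Lemma palinX N p n : palin N p -> palin (N * n) (p ^+ n).
Proof.
move=> pp; elim: n => [|n IH]; first by rewrite muln0 expr0; apply: palin1.
by rewrite exprS mulnS; apply: palinM.
Qed.

Lemma palin_psum N p t : palin N p -> (t <= N.+1)%N ->
  psum t p + psum (N.+1 - t) p = p.[1].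
Proof.
move=> [zp pp] tN; rewrite -(psum_horner N.+1) //.
have : psum (t + (N.+1 - t)) p = psum t p + \sum_(i < N.+1 - t) p`_(t + i).
  by rewrite /psum big_split_ord.
rewrite subnKC // => ->; congr (_ + _).
rewrite (reindex_inj rev_ord_inj) /=; apply: eq_bigr => i _.
have iN := ltn_ord i; rewrite pp; last by lia.
by congr (p`_ _); lia.
Qed.

(** The partial sums at t and N + 1 - t add up to 1 and differ by at most c coefficients, each at
    most [eta]. *)
Lemma palin_half N p t c eta : palin N p -> nnegp p -> p.[1] = 1 ->
  (forall k, p`_k <= eta) -> (2 * t <= N.+1 + c)%N -> (N.+1 <= 2 * t + c)%N ->
  `|psum t p - 1 / 2| <= c%:R * eta / 2.
Proof.
move=> pp p0 p1 pe h1 h2.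
have pe' k : `|p`_k| <= eta by rewrite ger0_norm.
have eta0 : 0 <= eta by apply: le_trans (pe 0%N).
(* If t > N + 1 the partial sum is 1, but then N + 1 < c, and total mass 1 on N + 1 coefficients
   forces c * eta >= 1. *)
case: (leqP t N.+1) => tN; last first.
  have e1 : psum t p = 1 by rewrite psum_horner //; case: pp => zp _; apply: leq_trans zp (ltnW tN).
  have := psum_dist 0 N.+1 p eta pe'; rewrite add0n.
  rewrite psum_horner ?p1 /psum ?big_ord0 ?subr0 ?normr1; last by case: pp.
  have : N.+1%:R * eta <= c%:R * eta by rewrite ler_wpM2r // ler_nat; lia.
  rewrite -/(psum _ _) e1 ger0_norm; last by lra.
  by lra.
have := palin_psum _ _ _ pp tN; rewrite p1.
have cd (d : nat) x : (d <= c)%N -> x <= d%:R * eta -> x <= c%:R * eta.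
  by move=> dc /le_trans; apply; rewrite ler_wpM2r // ler_nat.
case: (leqP t (N.+1 - t)) => tN'.
  have := psum_dist t (N.+1 - t - t) p eta pe'; rewrite subnKC // => /cd.
  move=> /(_ _)/[!ler_norml] H E; have {}H := H ltac:(lia).
  move/andP: H => [H1 H2]; apply/andP; split; lra.
have := psum_dist (N.+1 - t) (t - (N.+1 - t)) p eta pe'; rewrite subnKC ?(ltnW tN') // => /cd.
move=> /(_ _)/[!ler_norml] H E; have {}H := H ltac:(lia).
move/andP: H => [H1 H2]; apply/andP; split; lra.
Qed.

(** Convolution with a probability law averages coefficients, so it cannot raise their maximum. *)
Lemma coefM_le s u eta : nnegp s -> nnegp u -> u.[1] = 1 ->
  (forall k, s`_k <= eta) -> forall k, (u * s)`_k <= eta.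
Proof.
move=> s0 u0 u1 se k; rewrite coefM.
have eta0 : 0 <= eta by apply: le_trans (se 0%N).
apply: (@le_trans _ _ (\sum_(j < k.+1) u`_j * eta)).
  by apply: ler_sum => j _; rewrite ler_wpM2l.
by rewrite -mulr_suml ler_piMl // -u1; apply: psum_le_horner.
Qed.

Lemma psumM t u s : psum t (u * s) = \sum_(j < size u) u`_j * psum (t - j) s.
Proof.
elim: t => [|t IH].
  by rewrite /psum big_ord0 big1 // => j _; rewrite sub0n big_ord0 mulr0.
rewrite /psum big_ord_recr /= -/(psum t (u * s)) IH.
rewrite coefM.
have -> : \sum_(j < t.+1) u`_j * s`_(t - j) = \sum_(j < size u | (j <= t)%N) u`_j * s`_(t - j).
  have h : (t.+1 <= t.+1 + size u)%N by rewrite leq_addr.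
  have h' : (size u <= t.+1 + size u)%N by rewrite leq_addl.
  rewrite (big_ord_widen _ (fun j => u`_j * s`_(t - j)) h).
  rewrite (big_ord_widen_cond _ (fun j => (j <= t)%N) (fun j => u`_j * s`_(t - j)) h').
  rewrite [LHS](bigID (fun j : 'I__ => (j < size u)%N)) /= [X in _ + X]big1 ?addr0.
    by apply: eq_bigl => j; rewrite ltnS.
  by move=> j /andP[_ jM]; rewrite nth_default ?mul0r // leqNgt.
rewrite [X in _ + X]big_mkcond -big_split; apply: eq_bigr => j _ /=.
case: leqP => jt; first by rewrite -mulrDr subSn // /psum big_ord_recr.
by rewrite addr0; congr (_ * psum _ _); lia.
Qed.

(** An independent summand with values in 0..e moves the threshold by at most e, hence the centring
    defect by at most 2e. *)
Lemma palin_mul_half N s u e t c eta : palin N s -> nnegp s -> s.[1] = 1 ->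
  nnegp u -> u.[1] = 1 -> (size u <= e.+1)%N ->
  (forall k, s`_k <= eta) -> (2 * t <= N.+1 + c)%N -> (N.+1 <= 2 * t + c)%N ->
  `|psum t (u * s) - 1 / 2| <= (c + 2 * e)%:R * eta / 2.
Proof.
move=> ps s0 s1 u0 u1 zu se h1 h2.
have su : \sum_(j < size u) u`_j = 1 by rewrite -u1 -(psum_horner (size u)).
have scale x : x = \sum_(j < size u) u`_j * x by rewrite -mulr_suml su mul1r.
rewrite psumM [1 / 2]scale -sumrB.
apply: le_trans (ler_norm_sum _ _ _) _.
rewrite [leRHS]scale; apply: ler_sum => j _.
rewrite -mulrBr normrM ger0_norm // ler_wpM2l //.
have := ltn_ord j; move=> ju.
by apply: (palin_half N) => //; lia.
Qed.
End PartialSums.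

(** * Conditional law of the number of voters ranking candidate 3 above 4 *)

Section ThirdCandidate.
Variable R : realType.
Implicit Types th : R.

Definition linp (a b : R) : {poly R} := a%:P + b%:P * 'X.

Lemma coef_linp a b k : (linp a b)`_k = if k == 0%N then a else if k == 1%N then b else 0.
Proof.
rewrite coefD coefC coefMX coefC; case: k => [|[|k]] //=; rewrite ?addr0 ?add0r //.
Qed.

Lemma nnegp_linp a b : 0 <= a -> 0 <= b -> nnegp _ (linp a b).
Proof. by move=> a0 b0 k; rewrite coef_linp; case: ifP => // _; case: ifP. Qed.

Lemma horner1_linp a b : (linp a b).[1] = a + b.
Proof. by rewrite /linp !hornerE. Qed.

Lemma size_linp a b : (size (linp a b) <= 2)%N.
Proof.
by apply/leq_sizeP => j j2; rewrite coef_linp; case: j j2 => [|[]].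
Qed.

Lemma coef_fair D k : (linp (1 / 2) (1 / 2) ^+ D)`_k = fairbin R D k.
Proof.
have -> : linp (1 / 2) (1 / 2) = (2^-1)%:P * (1 + 'X).
  by rewrite /linp !div1r mulrDr mulr1.
rewrite exprMn -polyC_exp coefCM exprDn coef_sum exprVn mulrC; congr (_ * _).
under eq_bigr do rewrite expr1n mul1r coefMn coefXn.
case: (leqP k D) => kD.
  rewrite (bigD1 (Ordinal (kD : k < D.+1)%N)) //= eqxx big1 ?addr0 // => i.
  by rewrite -val_eqE /= eq_sym => /negbTE ->; rewrite mul0rn.
rewrite bin_small // big1 // => i _; have := ltn_ord i; rewrite ltnS => iD.
by rewrite (_ : (k == i) = false) ?mul0rn //; apply/eqP; lia.
Qed.

(** Here D voters separate 1 and 2, A voters rank both above 4, and B rank both below it. *)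
Definition third th D A B : {poly R} :=
  linp (1 / 2) (1 / 2) ^+ D * linp th (1 - th) ^+ A * linp (1 - th) th ^+ B.

Lemma third_nneg th D A B : 0 <= th <= 1 -> nnegp _ (third th D A B).
Proof.
case/andP=> t0 t1; have s0 : 0 <= 1 - th by rewrite subr_ge0.
by do 2?apply: nnegpM; apply/nnegpX/nnegp_linp => //; rewrite divr_ge0.
Qed.

Lemma third_horner1 th D A B : (third th D A B).[1] = 1.
Proof.
by rewrite /third !hornerM !horner_exp !horner1_linp -splitr subrK subrKC !expr1n !mulr1.
Qed.

(** Pairing each of the A factors with its mirror image leaves a palindrome of degree D + 2A and e
    unpaired factors. The D fair factors bound all coefficients by 1 / sqrt(D + 1). *)
Lemma third_half th D A e t c : 0 <= th <= 1 ->
  (2 * t <= (D + 2 * A).+1 + c)%N -> ((D + 2 * A).+1 <= 2 * t + c)%N ->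
  `|psum _ t (third th D A (A + e)) - 1 / 2| <= (c + 2 * e)%:R / 2 * Num.sqrt D.+1%:R^-1.
Proof.
move=> th01 h1 h2; case/andP: (th01) => t0 t1.
have s0 : 0 <= 1 - th by rewrite subr_ge0.
have -> : third th D A (A + e) = linp (1 - th) th ^+ e * third th D A A.
  by rewrite /third exprD; ring.
rewrite mulrAC.
apply: (palin_mul_half _ (D + 2 * A)) => //.
- rewrite /third -mulrA -exprMn -{1}[D]mul1n; apply: palinM; apply: palinX.
    split; first exact: size_linp.
    by case=> [|[|k]] // _; rewrite !coef_linp.
  split.
    apply: leq_trans (size_polyMleq _ _) _.
    by have := size_linp th (1 - th); have := size_linp (1 - th) th; lia.
  case=> [|[|[|k]]] // _; rewrite !coefM !big_ord_recl !big_ord0 !coef_linp /=; ring.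
- exact: third_nneg.
- exact: third_horner1.
- by apply/nnegpX/nnegp_linp.
- by rewrite horner_exp horner1_linp subrK expr1n.
- by apply: leq_trans (size_poly_exp_leq _ _) _; have := size_linp (1 - th) th; nia.
- have -> : third th D A A = (linp th (1 - th) ^+ A * linp (1 - th) th ^+ A) *
     linp (1 / 2) (1 / 2) ^+ D by rewrite /third; ring.
  apply: coefM_le.
  + by apply/nnegpX/nnegp_linp; rewrite divr_ge0.
  + by apply: nnegpM; apply/nnegpX/nnegp_linp.
  + by rewrite hornerM !horner_exp !horner1_linp subrK subrKC !expr1n mulr1.
  + move=> k; rewrite coef_fair sqrtrV // -[leRHS]mul1r ler_pdivlMr ?sqrtr_gt0 // mulrC.
    exact: nfairbin_le1.
Qed.
End ThirdCandidate.

(** * One cell of the mixture decomposition *)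

Section Cell.
Variables (R : realType) (th : R).
Hypothesis th01 : 0 <= th <= 1.

(* d voters separate candidates 1 and 2; a of the others rank both above 4, and
   b of the d rank only candidate 1 above 4. *)
Definition cell n k1 k2 t d : R :=
  \sum_(a < (n - d).+1) \sum_(b < d.+1)
    fairbin R (n - d)%N a * fairbin R d b * psum R t (third R th d a (n - d - a)%N)
    * ((a + b == k1) && (a + (d - b) == k2))%N%:R.

(** The prescribed counts force 2a = k1 + k2 - d and 2b = d + k1 - k2, so the double sum has at most
    one nonzero term. *)
Lemma cellE n k1 k2 t d a b : (a <= n - d)%N -> (b <= d)%N ->
  (a + b = k1)%N -> (a + (d - b) = k2)%N ->
  cell n k1 k2 t d =
  fairbin R (n - d)%N a * fairbin R d b * psum R t (third R th d a (n - d - a)%N).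
Proof.
move=> an bd e1 e2; rewrite /cell -ltnS in an; rewrite -ltnS in bd.
rewrite /cell (bigD1 (Ordinal an)) //= [X in _ + X]big1 ?addr0 => [|a' na].
  rewrite (bigD1 (Ordinal bd)) //= [X in _ + X]big1 ?addr0 => [|b' nb].
    by rewrite e1 e2 !eqxx mulr1.
  rewrite (_ : _ && _ = false) ?mulr0 //.
  by apply/negP => /andP[/eqP h1 /eqP h2]; case/eqP: nb; apply: val_inj => /=; lia.
apply: big1 => b' _; rewrite (_ : _ && _ = false) ?mulr0 //.
have := ltn_ord b'; have := ltn_ord a' => h3 h4.
by apply/negP => /andP[/eqP h1 /eqP h2]; case/eqP: na; apply: val_inj => /=; lia.
Qed.

Lemma cell0 n k1 k2 t d :
  (forall a b, (a <= n - d)%N -> (b <= d)%N -> (a + b = k1)%N -> (a + (d - b) = k2)%N -> False) ->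
  cell n k1 k2 t d = 0.
Proof.
move=> h; apply: big1 => a _; apply: big1 => b _.
rewrite (_ : _ && _ = false) ?mulr0 //; apply/negP => /andP[/eqP h1 /eqP h2].
by apply: (h a b) => //; rewrite -ltnS.
Qed.

Definition ncell n k1 k2 t d : R :=
  Num.sqrt (d.+1%:R * (n - d).+1%:R) * cell n k1 k2 t d.

Lemma ncellE n k1 k2 t d a b : (a <= n - d)%N -> (b <= d)%N ->
  (a + b = k1)%N -> (a + (d - b) = k2)%N ->
  ncell n k1 k2 t d =
  nfairbin R (n - d)%N a * nfairbin R d b * psum R t (third R th d a (n - d - a)%N).
Proof.
move=> an bd e1 e2; rewrite /ncell (cellE _ _ _ _ _ _ _ an bd e1 e2) sqrtrM //.
by rewrite /nfairbin; ring.
Qed.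

Lemma ncell_itv n k1 k2 t d : 0 <= ncell n k1 k2 t d <= 1.
Proof.
have [[a [b [an bd e1 e2]]]|h] := pselect (exists a b, [/\ (a <= n - d)%N,
    (b <= d)%N, (a + b = k1)%N & (a + (d - b) = k2)%N]); last first.
  rewrite /ncell cell0 ?mulr0 ?lexx ?ler01 // => a b an bd e1 e2.
  by apply: h; exists a, b.
rewrite (ncellE _ _ _ _ _ _ _ an bd e1 e2).
have p0 := psum_ge0 _ t _ (third_nneg R th d a (n - d - a) th01).
have p1 := psum_le_horner _ t _ (third_nneg R th d a (n - d - a) th01).
rewrite third_horner1 in p1.
rewrite !mulr_ge0 ?nfairbin_ge0 //=.
by rewrite mulr_ile1 ?mulr_ge0 ?nfairbin_ge0 // mulr_ile1 ?nfairbin_ge0 ?nfairbin_le1.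
Qed.

Lemma prod3_dist (u v w s h : R) : 0 <= u <= 1 -> 0 <= v <= 1 -> 0 <= w <= 1 ->
  0 <= s <= 1 -> `|u * v * w - s ^+ 2 * h| <= `|u - s| + `|v - s| + `|w - h|.
Proof.
move=> /andP[u0 u1] /andP[v0 v1] /andP[w0 w1] /andP[s0 s1].
have -> : u * v * w - s ^+ 2 * h = (u - s) * (v * w) + (v - s) * (s * w) + (w - h) * (s * s).
  by ring.
apply: le_trans (ler_normD _ _) _; apply: lerD; last first.
  by rewrite normrM ler_piMr // ger0_norm ?mulr_ge0 // mulr_ile1.
apply: le_trans (ler_normD _ _) _.
by apply: lerD; rewrite normrM ler_piMr // ger0_norm ?mulr_ge0 // mulr_ile1.
Qed.

(** With c = i + j + 2, 8c^2 + 2c + 2 is the constant of [nfairbin_cvg]; the remaining 3c absorbs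
    the error 3c / 2 from candidate 3. *)
Definition cell_bound i j : R :=
  8 * (i + j + 2)%:R ^+ 2 + 5 * (i + j + 2)%:R + 2.

Lemma inv_le_sqrt_inv n : n.+1%:R^-1 <= Num.sqrt (n.+1%:R^-1) :> R.
Proof.
have x0 : 0 <= n.+1%:R^-1 :> R by rewrite invr_ge0.
have x1 : n.+1%:R^-1 <= 1 :> R by rewrite invf_le1 ?ltr0n // ler1n.
rewrite -{1}(sqr_sqrtr x0) expr2 ler_piMr ?sqrtr_ge0 //.
by rewrite -[leRHS]sqrtr1 ler_wsqrtr.
Qed.

Lemma cell_index n m i j d : (m.*2 < n <= m.*2.+2)%N -> (i <= m)%N -> (j <= m)%N ->
  ~~ odd (i + j + d)%N -> (i + j + 2 <= d)%N -> (i + j + 2 <= n - d)%N ->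
  exists a b e, [/\ (a <= n - d)%N /\ (b <= d)%N, (a + b = m - i)%N /\ (a + (d - b) = m - j)%N,
   (n - d - a = a + e)%N /\ (e <= i + j + 2)%N,
   ((2 * a <= n - d + (i + j + 2))%N /\ (n - d <= 2 * a + (i + j + 2))%N) /\
   ((2 * b <= d + (i + j + 2))%N /\ (d <= 2 * b + (i + j + 2))%N) &
   (2 * m.+1 <= (d + 2 * a).+1 + (i + j + 2))%N /\
   ((d + 2 * a).+1 <= 2 * m.+1 + (i + j + 2))%N].
Proof.
rewrite -mul2n => /andP[nm1 nm2] im jm par de nde.
have [c ec] : exists c, (i + j + d = 2 * c)%N.
  by exists (i + j + d)./2; rewrite mul2n -[LHS](odd_double_half) (negbTE par).
clear par; have cm : (c <= m)%N by lia.
(* The solution of the two count equations. The last witness equals n - 2m + i + j, at most i + j +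
   2 because n is 2m + 1 or 2m + 2. *)
exists (m - c)%N, (c - i)%N, (n - d - (m - c) - (m - c))%N.
by repeat split; lia.
Qed.

(** The value 1 / pi is [mid_const ^+ 2 * (1 / 2)]: two central binomials and the half for candidate
    3. For the wrong parity of d the cell is empty. *)
Lemma ncell_dist n m i j d : (m.*2 < n <= m.*2.+2)%N -> (i <= m)%N ->
  (j <= m)%N -> (d <= n)%N ->
  `|ncell n (m - i)%N (m - j)%N m.+1 d - (~~ odd (i + j + d)%N)%:R / pi| <=
  cell_bound i j * (Num.sqrt d.+1%:R^-1 + Num.sqrt (n - d).+1%:R^-1).
Proof.
move=> nm im jm dn; set e0 := (i + j + 2)%N.
have e00 : 1 <= e0%:R :> R by rewrite ler1n /e0; lia.
have e02 : 0 <= e0%:R ^+ 2 :> R by exact: sqr_ge0.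
have B0 : 0 <= cell_bound i j by rewrite /cell_bound -/e0; lra.
have sd := sqrtr_ge0 (d.+1%:R^-1 : R); have sn := sqrtr_ge0 ((n - d).+1%:R^-1 : R).
have rhs0 : 0 <= cell_bound i j * (Num.sqrt d.+1%:R^-1 + Num.sqrt (n - d).+1%:R^-1).
  by rewrite mulr_ge0 // addr_ge0.
case: (boolP (odd (i + j + d)%N)) => [par|par] /=.
  rewrite mul0r subr0 /ncell cell0 ?mulr0 ?normr0 // => a b an bd e1 e2.
  move: par; rewrite (_ : i + j + d = (m - a).*2)%N ?odd_double //.
  by move: e1 e2 im jm bd; clear; lia.
rewrite mul1r.
(* When d or n - d is below e0 the claimed error exceeds 1, and the trivial bound does. *)
have big (x : nat) : (x < e0)%N -> 1 <= cell_bound i j * Num.sqrt x.+1%:R^-1.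
  move=> xe; apply: (@le_trans _ _ (e0%:R * x.+1%:R^-1)).
    by rewrite ler_pdivlMr ?ltr0n // mul1r ler_nat.
  apply: ler_pM => //; last exact: inv_le_sqrt_inv.
  by rewrite /cell_bound -/e0; lra.
have triv : `|ncell n (m - i)%N (m - j)%N m.+1 d - pi^-1| <= 1.
  have /andP[h0 h1] := ncell_itv n (m - i)%N (m - j)%N m.+1 d.
  have q0 : 0 <= pi^-1 :> R by rewrite invr_ge0 pi_ge0.
  have q1 : pi^-1 <= 1 :> R.
    by rewrite invf_le1 ?pi_gt0 // (le_trans _ (pi_ge2 R)) // ler1n.
  by rewrite ler_norml; apply/andP; split; lra.
case: (ltnP d e0) => [/big h|de].
  by rewrite (le_trans triv) // (le_trans h) // mulrDr lerDl mulr_ge0.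
case: (ltnP (n - d) e0) => [/big h|nde].
  by rewrite (le_trans triv) // (le_trans h) // mulrDr lerDr mulr_ge0.
have [a [b [e [[an bd] [e1 e2] [ee el] [[a1 a2] [b1 b2]] [t1 t2]]]]] :=
  cell_index _ _ _ _ _ nm im jm par de nde.
rewrite (ncellE _ _ _ _ _ a b) //.
have s01 : 0 <= mid_const R <= 1.
  by have /andP[s1 ->] := mid_const_itv R; rewrite andbT; lra.
have -> : pi^-1 = mid_const R ^+ 2 * (1 / 2) by rewrite mid_const_sqr; move: (pi : R) => P; lra.
apply: le_trans (prod3_dist _ _ _ _ _ _ _ _ s01) _.
- by rewrite nfairbin_ge0 nfairbin_le1.
- by rewrite nfairbin_ge0 nfairbin_le1.
- have := third_nneg R th d a (n - d - a) th01 => tn.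
  by rewrite (psum_ge0 _ _ _ tn) -(third_horner1 R th d a (n - d - a)%N) (psum_le_horner _ _ _ tn).
have K0 : 0 <= 8 * e0%:R ^+ 2 + 2 * e0%:R + 2 :> R by lra.
have h1 : `|nfairbin R (n - d)%N a - mid_const R| <=
    (8 * e0%:R ^+ 2 + 2 * e0%:R + 2) * Num.sqrt (n - d).+1%:R^-1.
  apply: le_trans (nfairbin_cvg R e0 _ _ _ _) _ => //.
  by rewrite ler_wpM2l // inv_le_sqrt_inv.
have h2 : `|nfairbin R d b - mid_const R| <=
    (8 * e0%:R ^+ 2 + 2 * e0%:R + 2) * Num.sqrt d.+1%:R^-1.
  apply: le_trans (nfairbin_cvg R e0 _ _ _ _) _ => //.
  by rewrite ler_wpM2l // inv_le_sqrt_inv.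
have h3 : `|psum R m.+1 (third R th d a (n - d - a)%N) - 1 / 2| <=
    (3 * e0%:R / 2) * Num.sqrt d.+1%:R^-1.
  rewrite ee; apply: le_trans (third_half R th d a e m.+1 e0 th01 _ _) _ => //.
  rewrite ler_wpM2r // ler_pM2r // natrD natrM.
  by have : e%:R <= e0%:R :> R; [rewrite ler_nat | lra].
rewrite /cell_bound -/e0.
move: h1 h2 h3 sd sn.
move: (Num.sqrt (n - d).+1%:R^-1) (Num.sqrt d.+1%:R^-1) => x y h1 h2 h3 y0 x0.
have hx : 0 <= e0%:R * x by rewrite mulr_ge0 //; lra.
have hy : 0 <= e0%:R * y by rewrite mulr_ge0 //; lra.
by lra.
Qed.
End Cell.

(** * Local limit of the tilted vote counts *)

Section Mass.
Local Open Scope classical_set_scope.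
Local Open Scope ring_scope.
Variables (R : realType) (p th : R).
Hypothesis p01 : 0 < p < 1.
Hypothesis th01 : 0 <= th <= 1.

Let p_gt0 : 0 < p. Proof. by case/andP: p01. Qed.
Let p_lt1 : 0 < 1 - p. Proof. by rewrite subr_gt0; case/andP: p01. Qed.
Let p01W : 0 <= p <= 1. Proof. by case/andP: p01 => ? ?; rewrite !ltW. Qed.
Let s0 : 0 < bin_sd R p. Proof. exact: bin_sd_gt0. Qed.

(** For n > 0, the largest number of voters that may rank a candidate above 4 while 4 keeps a strict
    majority against it. *)
Definition max_minority n := (uphalf n - 1)%N.

(** For i, j up to [max_minority n]: the tilted probability that candidates 1 and 2 fall short of
    the maximal admissible count by exactly i and j, while candidate 3 is admissible. *)
Definition mass n i j : R :=
  binE R p n (cell R th n (max_minority n - i)%N (max_minority n - j)%N (max_minority n).+1).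

Lemma massE n i j : (0 < n)%N -> n%:R * mass n i j = binE R p n (fun d =>
  invgm R n d * ncell R th n (max_minority n - i)%N (max_minority n - j)%N (max_minority n).+1 d).
Proof.
move=> n0; rewrite /mass -binEZ; apply: binE_ext => d dn.
rewrite /invgm /ncell mulrA divfK // lt0r_neq0 // sqrtr_gt0 mulr_gt0 //.
Qed.

Lemma mass_ge0 n i j : (0 < n)%N -> 0 <= n%:R * mass n i j.
Proof.
move=> n0; rewrite massE //; apply: binE_ge0 => // d dn.
rewrite mulr_ge0 ?(ltW (invgm_gt0 _ _ _ n0)) //.
by case/andP: (ncell_itv R th th01 n (max_minority n - i)%N (max_minority n - j)%N (max_minority n).+1 d).
Qed.

(** A bound uniform in n, i and j: the domination for the geometric sums. *)
Lemma mass_le n i j : (0 < n)%N ->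
  n%:R * mass n i j <= Num.sqrt (bin_sd R p ^+ 4)^-1 + (bin_sd R p)^-1.
Proof.
move=> n0; rewrite massE //.
apply: (@le_trans _ _ (binE R p n (fun d => `|invgm R n d - (bin_sd R p)^-1| + (bin_sd R p)^-1))).
  apply: binE_le => // d dn.
  have /andP[h0 h1] := ncell_itv R th th01 n (max_minority n - i)%N (max_minority n - j)%N (max_minority n).+1 d.
  rewrite (le_trans (ler_piMr (ltW (invgm_gt0 _ _ _ n0)) h1)) //.
  by rewrite -lerBlDr ler_norm.
rewrite binED binE_cst lerD2r (le_trans (binE_invgm_dist _ _ p01 _ n0)) //.
rewrite ler_wsqrtr // lef_pV2 ?posrE ?mulr_gt0 ?exprn_gt0 ?ltr0n //.
by rewrite ler_peMr ?exprn_ge0 ?(ltW s0) // ler1n.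
Qed.

(** The parity indicator is (1 + (-1)^(c + d)) / 2, and the generating function at -1 is (1 - 2p)^n,
    which decays for 0 < p < 1. *)
Lemma binE_even n c :
  binE R p n (fun d => (~~ odd (c + d)%N)%:R) = 1 / 2 + (-1) ^+ c * (1 - 2 * p) ^+ n / 2.
Proof.
rewrite (binE_ext _ _ _ _ (fun d => 1 / 2 + (-1) ^+ c / 2 * (-1) ^+ d)).
  rewrite binED binE_cst binEZ binE_exp.
  by have -> : 1 - p + p * -1 = 1 - 2 * p; [ring | rewrite mulrAC].
move=> d _; have -> : (-1) ^+ c / 2 * (-1) ^+ d = (-1) ^+ (c + d) / 2 :> R.
  by rewrite exprD; ring.
rewrite -signr_odd; case: (odd _) => /=; rewrite ?expr1 ?expr0; lra.
Qed.

Lemma mass_dist n i j : (0 < n)%N -> (i <= max_minority n)%N -> (j <= max_minority n)%N ->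
  `|n%:R * mass n i j - (2 * pi * bin_sd R p)^-1| <=
  Num.sqrt (bin_sd R p ^+ 4 * n%:R)^-1 +
  (bin_sd R p)^-1 * (cell_bound R i j *
     (Num.sqrt (p * n.+1%:R)^-1 + Num.sqrt ((1 - p) * n.+1%:R)^-1)) +
  (bin_sd R p)^-1 * `|1 - 2 * p| ^+ n.
Proof.
move=> n0 im jm; rewrite massE //.
set N := ncell R th n _ _ _.
pose par d : R := (~~ odd (i + j + d)%N)%:R.
set y0 := (bin_sd R p)^-1; have y00 : 0 <= y0 by rewrite invr_ge0 ltW.
have pi0 := pi_gt0 R.
(* The three terms of the error bound: fluctuation of [invgm], local error of the cell, and bias of
   the parity of d. *)
have -> : (fun d => invgm R n d * N d) = (fun d => ((invgm R n d - y0) * N d +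
    y0 * (N d - par d / pi)) + (y0 / pi) * par d).
  by apply/funext => d; move: (pi : R) => P; ring.
rewrite !binED !binEZ /par binE_even.
set E1 := binE _ _ _ _; set E2 := binE _ _ _ _.
have -> : E1 + y0 * E2 + y0 / pi * (1 / 2 + (-1) ^+ (i + j) * (1 - 2 * p) ^+ n / 2) -
   (2 * pi * bin_sd R p)^-1 = E1 + y0 * E2 + y0 * ((-1) ^+ (i + j) * (1 - 2 * p) ^+ n / (2 * pi)).
  rewrite /y0; move: (lt0r_neq0 pi0) (lt0r_neq0 s0); move: (pi : R) (bin_sd R p) => P s hP hs.
  by field; rewrite hP hs.
apply: le_trans (ler_normD _ _) _; apply: lerD; last first.
  rewrite normrM ger0_norm // ler_wpM2l // !normrM normrX normrN1 expr1n mul1r normrX.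
  rewrite ler_piMr ?exprn_ge0 // ger0_norm ?invr_ge0 ?mulr_ge0 ?(ltW pi0) //.
  have h2 := pi_ge2 R; rewrite invf_le1 ?mulr_gt0 //; move: (pi : R) h2 => P; lra.
apply: le_trans (ler_normD _ _) _; apply: lerD.
  apply: le_trans (ler_norm_binE _ _ _ p01W _) _.
  apply: le_trans (binE_invgm_dist _ _ p01 _ n0).
  apply: binE_le => // d dn; rewrite normrM ler_piMr //.
  have /andP[h0 h1] := ncell_itv R th th01 n (max_minority n - i)%N (max_minority n - j)%N (max_minority n).+1 d.
  by rewrite ger0_norm.
rewrite normrM ger0_norm // ler_wpM2l //.
apply: le_trans (ler_norm_binE _ _ _ p01W _) _.
apply: (@le_trans _ _ (binE R p n (fun d => cell_bound R i j *
    (Num.sqrt d.+1%:R^-1 + Num.sqrt (n - d).+1%:R^-1)))).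
  apply: binE_le => // d dn; apply: ncell_dist => //.
  by rewrite /max_minority; move: n0; clear; lia.
rewrite binEZ ler_wpM2l //.
  rewrite /cell_bound; have := sqr_ge0 ((i + j + 2)%:R : R); have := ler0n R (i + j + 2)%N; lra.
by rewrite binED lerD ?binE_sqrt_inv ?binE_sqrt_inv_rev.
Qed.

Lemma sqrt_inv_cvg0 (c : R) : 0 < c ->
  (fun n : nat => Num.sqrt (c * n.+1%:R)^-1) @ \oo --> (0 : R).
Proof.
move=> c0.
have h : (fun n : nat => (c * n.+1%:R)^-1) @ \oo --> (0 : R).
  rewrite -(mulr0 c^-1); under eq_fun do rewrite invfM.
  by apply: cvgMl_tmp; exact: cvg_harmonic.
rewrite -sqrtr0; apply: (cvg_comp _ _ h); exact: sqrt_continuous.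
Qed.

Lemma mass_cvg i j : (fun n => n%:R * mass n i j) @ \oo --> (2 * pi * bin_sd R p)^-1.
Proof.
rewrite -cvg_shiftS /=.
pose g n := Num.sqrt (bin_sd R p ^+ 4 * n.+1%:R)^-1 +
  (bin_sd R p)^-1 * (cell_bound R i j *
     (Num.sqrt (p * n.+2%:R)^-1 + Num.sqrt ((1 - p) * n.+2%:R)^-1)) +
  (bin_sd R p)^-1 * `|1 - 2 * p| ^+ n.+1.
have g0 : g @ \oo --> (0 : R).
  have -> : 0 = 0 + (bin_sd R p)^-1 * (cell_bound R i j * (0 + 0)) + (bin_sd R p)^-1 * 0 :> R.
    by rewrite !(addr0, mulr0).
  have c1 := sqrt_inv_cvg0 _ (exprn_gt0 4 s0).
  have := sqrt_inv_cvg0 _ p_gt0; rewrite -cvg_shiftS => c2.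
  have := sqrt_inv_cvg0 _ p_lt1; rewrite -cvg_shiftS => c3.
  have := @cvg_expr R `|1 - 2 * p| _; rewrite -cvg_shiftS => c4.
  apply: cvgD; last first.
    apply: cvgMl_tmp; apply: c4; rewrite normr_id ltr_norml; move/andP: p01 => [? ?].
    by apply/andP; split; lra.
  apply: cvgD; first exact: c1.
  by apply: cvgMl_tmp; apply: cvgMl_tmp; apply: cvgD.
apply/cvgrPdist_le => e e0.
move/cvgrPdist_le: g0 => /(_ e e0) [N1 _ gN].
exists (maxn N1 (2 * (i + j) + 4)) => // n /=; rewrite geq_max => /andP[/gN /= h nij].
rewrite sub0r normrN in h; rewrite distrC.
apply: le_trans (mass_dist _ _ _ _ _ _) _; rewrite ?/max_minority //; [lia|lia|].
exact: le_trans (ler_norm _) h.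
Qed.

End Mass.

(** * Dominated convergence for geometric weights over growing ranges *)

Section Tannery.
Variable R : realType.
Local Open Scope classical_set_scope.
Local Open Scope ring_scope.

Lemma geom_sumE (z : R) N : z < 1 ->
  \sum_(k < N) z ^+ k = (1 - z ^+ N) / (1 - z).
Proof.
move=> z1; have z2 : 1 - z != 0 by rewrite subr_eq0 eq_sym lt_eqF.
apply: (mulIf z2); rewrite divfK // mulrC.
by rewrite -[1 - z ^+ N]opprB subrX1 -mulNr opprB.
Qed.

Lemma geom_sum_le (z : R) N : 0 <= z < 1 -> \sum_(k < N) z ^+ k <= (1 - z)^-1.
Proof.
case/andP=> z0 z1; rewrite geom_sumE // ler_piMl ?invr_ge0 ?subr_ge0 ?(ltW z1) //.
by rewrite gerBl exprn_ge0.
Qed.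

(** After subtracting l, whose geometric sum is explicit, the first K terms vanish in the limit and
    the rest is at most z^K (C + |l|) / (1 - z). *)
Lemma tannery (z C l : R) (g : nat -> nat -> R) (M : nat -> nat) : 0 <= z < 1 ->
  M @ \oo --> \oo ->
  (forall n k, `|g n k| <= C) ->
  (forall k, (g ^~ k) @ \oo --> l) ->
  (fun n => \sum_(k < M n) z ^+ k * g n k) @ \oo --> l / (1 - z).
Proof.
move=> z01 Moo gC gl; have /andP[z0 z1] := z01.
have z2 : 0 < 1 - z by rewrite subr_gt0.
have zn0 : GRing.exp z @ \oo --> (0 : R) by apply: cvg_expr; rewrite ger0_norm.
have -> : (fun n => \sum_(k < M n) z ^+ k * g n k) =
   (fun n => \sum_(k < M n) z ^+ k * (g n k - l) + l * ((1 - z ^+ M n) / (1 - z))).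
  apply/funext => n; rewrite -geom_sumE // mulr_sumr -big_split /=.
  by apply: eq_bigr => k _; ring.
rewrite -[l / _]add0r; apply: cvgD; last first.
  have h : (fun n => (1 - z ^+ M n) * (1 - z)^-1) @ \oo --> (1 - 0) * (1 - z)^-1.
    apply: cvgMr_tmp; apply: cvgB; first exact: cvg_cst.
    exact: (cvg_comp _ _ Moo zn0).
  by apply: cvgMl_tmp; rewrite subr0 mul1r in h.
have C0 : 0 <= C + `|l| by rewrite addr_ge0 // (le_trans _ (gC 0%N 0%N)).
have tail_cvg : (fun K => z ^+ K * ((C + `|l|) / (1 - z))) @ \oo --> (0 : R).
  by rewrite -(mul0r ((C + `|l|) / (1 - z))); apply: cvgMr_tmp.
have head_cvg K : (fun n => \sum_(k < K) z ^+ k * `|g n k - l|) @ \oo --> (0 : R).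
  elim: K => [|K IH].
    by under eq_fun do rewrite big_ord0; exact: cvg_cst.
  under eq_fun do rewrite big_ord_recr /=.
  have h : (fun n => z ^+ K * `|g n K - l|) @ \oo --> z ^+ K * `|l - l|.
    by apply: cvgMl_tmp; apply: cvg_norm; apply: cvgB => //; exact: cvg_cst.
  by rewrite subrr normr0 mulr0 in h; have := cvgD IH h; rewrite addr0 => h2; exact: h2.
apply/cvgrPdist_le => e e0; have e2 : 0 < e / 2 by rewrite divr_gt0.
move/cvgrPdist_le: tail_cvg => /(_ _ e2) [K _ /(_ K (leqnn K))] /=.
rewrite sub0r normrN ger0_norm => [tailK|]; last first.
  by rewrite mulr_ge0 ?exprn_ge0 // divr_ge0 // ltW.
move/cvgrPdist_le: (head_cvg K) => /(_ _ e2) [N _ headN].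
exists N => // n /headN /=; rewrite !sub0r !normrN => headn.
apply: le_trans (ler_norm_sum _ _ _) _.
have nz k : `|z ^+ k * (g n k - l)| = z ^+ k * `|g n k - l|.
  by rewrite normrM ger0_norm ?exprn_ge0.
under eq_bigr do rewrite nz.
(* Extending the range makes the split at K legitimate even when [M n] is below K. *)
apply: (@le_trans _ _ (\sum_(k < K + M n) z ^+ k * `|g n k - l|)).
  rewrite addnC big_split_ord /= lerDl sumr_ge0 // => k _.
  by rewrite mulr_ge0 ?exprn_ge0.
rewrite big_split_ord /= (splitr e) lerD //; first exact: le_trans (ler_norm _) headn.
apply: le_trans tailK.
apply: (@le_trans _ _ (\sum_(k < M n) z ^+ k * (z ^+ K * (C + `|l|)))).
  apply: ler_sum => k _; rewrite exprD -mulrA mulrCA ler_wpM2l ?exprn_ge0 // ler_wpM2l ?exprn_ge0 //.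
  by rewrite (le_trans (ler_normB _ _)) // lerD2r.
rewrite -mulr_suml mulrC -mulrA ler_wpM2l ?exprn_ge0 // ler_wpM2l //.
exact: geom_sum_le.
Qed.

End Tannery.

(** * Generating function of the Mallows culture *)

Section MallowsGenerating.

Definition perms4 : seq (seq nat) := Eval vm_compute in permutations (iota 0 4).

(** The identity is only a default, never reached for l in [perms4]. *)
Definition perm_of_seq (l : seq nat) : 'S_4 :=
  insubd (1%g : 'S_4) [ffun i : 'I_4 => inord (nth 0%N l i) : 'I_4].

Lemma perm_of_seqE l (i : 'I_4) : l \in perms4 -> perm_of_seq l i = nth 0%N l i :> nat.
Proof.
move=> lp; have : [&& uniq l, size l == 4%N & all (fun k => (k < 4)%N) l].
  by move: l lp; apply/allP.
case/and3P=> ul /eqP sl /allP al.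
have lt4 (j : 'I_4) : (nth 0%N l j < 4)%N by apply/al/mem_nth; rewrite sl.
rewrite /perm_of_seq -pvalE insubdK.
  by rewrite ffunE inordK.
rewrite unfold_in /=; apply/injectiveP => j k; rewrite !ffunE => /(congr1 val) /=.
rewrite !inordK // => /eqP; rewrite nth_uniq ?sl // => /eqP; exact: val_inj.
Qed.

(** The 24 listed sequences give distinct permutations, and 24 = 4!, so none is missing. *)
Lemma sum_perm4 (A : nmodType) (F : 'S_4 -> A) :
  \sum_(r : 'S_4) F r = \sum_(l <- perms4) F (perm_of_seq l).
Proof.
rewrite -(big_map perm_of_seq predT F); apply: perm_big.
have u1 : uniq [seq perm_of_seq l | l <- perms4].
  rewrite map_inj_in_uniq // => l l' lp lp' /permP e.
  apply: (@eq_from_nth _ 0%N).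
    by have /allP h : all (fun l => size l == 4%N) perms4 by [];
       rewrite (eqP (h _ lp)) (eqP (h _ lp')).
  move=> i; have /allP h : all (fun l => size l == 4%N) perms4 by [].
  rewrite (eqP (h _ lp)) => i4.
  by have := congr1 val (e (Ordinal i4)); rewrite /= !perm_of_seqE.
apply: uniq_perm => //; first exact: index_enum_uniq.
move=> s; symmetry; apply: (uniq_min_size u1 (fun x _ => mem_index_enum x) _).2.
have -> : size (index_enum 'S_4) = #|'S_4| by rewrite cardT enumT.
by rewrite card_Sn size_map.
Qed.

Definition inv4 (l : seq nat) : nat :=
  (~~ (nth 0 l 0 < nth 0 l 1) + ~~ (nth 0 l 0 < nth 0 l 2) + ~~ (nth 0 l 0 < nth 0 l 3) +
   ~~ (nth 0 l 1 < nth 0 l 2) + ~~ (nth 0 l 1 < nth 0 l 3) + ~~ (nth 0 l 2 < nth 0 l 3))%N.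

Lemma kendall_perm_of_seq l : l \in perms4 -> kendall (perm_of_seq l) 1 = inv4 l.
Proof.
move=> lp; rewrite /kendall -sum1_card big_mkcond /=.
rewrite (eq_bigr (fun p : 'I_4 * 'I_4 => ((p.1 < p.2) && ~~ (nth 0 l p.1 < nth 0 l p.2))%N : nat)); last first.
  move=> [i j] _; rewrite inE /= !perm_of_seqE // !perm1.
  by case: (i < j)%N => //=; rewrite eqb_id; case: (_ < _)%N.
rewrite -(pair_bigA _ (fun i j : 'I_4 => ((i < j) && ~~ (nth 0 l i < nth 0 l j))%N : nat)) /=.
by rewrite !big_ord_recl !big_ord0 /= /bump /= /inv4 !add0n !addn0 !addnA.
Qed.

Variable A : comNzRingType.

(** Enumeration of the 24 rankings, over any commutative ring: it serves both for real arguments and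
    for formal variables. *)
Lemma sum_kendall_above (q : A) (x : 'I_3 -> A) :
  \sum_(r : 'S_4) q ^+ kendall r 1 * \prod_(j in above4 r) x j =
  (1 + q) * ((1 + q + q ^+ 2) * (q ^+ 3 + x 0 * x 1 * x 2) +
    q ^+ 2 * x 0 + q ^+ 3 * x 1 + q ^+ 4 * x 2 +
    q * x 0 * x 1 + q ^+ 2 * x 0 * x 2 + q ^+ 3 * x 1 * x 2).
Proof.
rewrite sum_perm4.
rewrite (eq_big_seq (fun l => q ^+ inv4 l *
   ((if (nth 0 l 0 < nth 0 l 3)%N then x 0 else 1) *
    (if (nth 0 l 1 < nth 0 l 3)%N then x 1 else 1) *
    (if (nth 0 l 2 < nth 0 l 3)%N then x 2 else 1)))); last first.
  move=> l lp; rewrite kendall_perm_of_seq //; congr (_ * _).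
  rewrite big_mkcond /= !big_ord_recl big_ord0 mulr1 mulrA.
  rewrite !inE !perm_of_seqE //=.
  have -> : lift ord0 (lift ord0 ord0) = 2 :> 'I_3 by apply/val_inj.
  by have -> : lift ord0 ord0 = 1 :> 'I_3 by apply/val_inj.
rewrite /perms4 !big_cons big_nil /inv4 /=.
by move: (x 0) (x 1) (x 2) => a b c; ring.
Qed.
End MallowsGenerating.

(** * The election probability as a sum of coefficients *)

Section RingIdentities.
Variable A : comNzRingType.

(** The mixture decomposition without division: h stands for 1/2, s for 1 - th, iz for the inverse
    normaliser, and the equations match the weights c q and c (1 + q + q^2) of the tilted sets. *)
Lemma tilt_identity (P pp qq h s th iz q y1 y2 x c : A) :
  c = iz * (q ^+ 3 * (1 + q)) ->
  P * pp * h * h = c * q -> P * qq * h * s = c * (1 + q + q ^+ 2) ->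
  P * qq * h * th = c * q ->
  let x0 := q ^+ 2 * y1 in let x1 := q * y2 in
  iz * ((1 + q) * ((1 + q + q ^+ 2) * (q ^+ 3 + x0 * x1 * x) +
    q ^+ 2 * x0 + q ^+ 3 * x1 + q ^+ 4 * x +
    q * x0 * x1 + q ^+ 2 * x0 * x + q ^+ 3 * x1 * x)) =
  P * (qq * (h * ((s + th * x) + y1 * y2 * (th + s * x))) +
       pp * (h * (y2 + y1) * (h + h * x))).
Proof.
move=> -> e1 e2 e3 x0 x1.
transitivity (P * pp * h * h * ((y1 + y2) * (1 + x)) +
  P * qq * h * s * (1 + y1 * y2 * x) + P * qq * h * th * (x + y1 * y2)); last by ring.
by rewrite e1 e2 e3 /x0 /x1; ring.
Qed.

Lemma mixture_expand (pp qq h v0 v1 y1 y2 L : A) n :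
  (qq * (h * (v0 + y1 * y2 * v1)) + pp * (h * (y2 + y1) * L)) ^+ n =
  \sum_(d < n.+1) \sum_(a < (n - d).+1) \sum_(b < d.+1)
    ('C(n, d)%:R * pp ^+ d * qq ^+ (n - d) * ('C(n - d, a)%:R * h ^+ (n - d)) *
     ('C(d, b)%:R * h ^+ d)) * (L ^+ d * v1 ^+ a * v0 ^+ (n - d - a)) *
    (y1 ^+ (a + b) * y2 ^+ (a + (d - b))).
Proof.
rewrite exprDn; apply: eq_bigr => d _.
rewrite -mulr_natl !exprMn !exprDn.
rewrite (_ : 'C(n, d)%:R * (qq ^+ (n - d) * (h ^+ (n - d) *
    \sum_(i < (n - d).+1) (v0 ^+ (n - d - i) * (y1 * y2 * v1) ^+ i *+ 'C(n - d, i))) *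
    (pp ^+ d * (h ^+ d * (\sum_(i < d.+1) (y2 ^+ (d - i) * y1 ^+ i *+ 'C(d, i))) * L ^+ d)))
  = (\sum_(i < (n - d).+1) (v0 ^+ (n - d - i) * (y1 * y2 * v1) ^+ i *+ 'C(n - d, i))) *
    (('C(n, d)%:R * pp ^+ d * qq ^+ (n - d) * h ^+ (n - d) * h ^+ d * L ^+ d) *
    \sum_(i < d.+1) (y2 ^+ (d - i) * y1 ^+ i *+ 'C(d, i)))); last by ring.
rewrite mulr_suml; apply: eq_bigr => a _.
rewrite mulr_sumr mulr_sumr; apply: eq_bigr => b _.
rewrite -[v0 ^+ _ * _ *+ _]mulr_natl -[y2 ^+ _ * _ *+ _]mulr_natl !exprMn !exprD.
move: ('C(n, d)%:R : A) ('C(n - d, a)%:R : A) ('C(d, b)%:R : A).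
move: (pp ^+ d) (qq ^+ (n - d)) (h ^+ (n - d)) (h ^+ d) (L ^+ d) (v1 ^+ a).
move: (v0 ^+ (n - d - a)) (y1 ^+ a) (y1 ^+ b) (y2 ^+ a) (y2 ^+ (d - b)) => *.
by ring.
Qed.
End RingIdentities.

(** * Coefficient extraction in three nested polynomial variables *)

Section NestedCoefficients.
Variable R : realType.
Notation A := {poly {poly {poly R}}}.

Definition scal (c : R) : A := c%:P%:P%:P.

Lemma scalM : {morph scal : x y / x * y}. Proof. by move=> x y; rewrite /scal !polyCM. Qed.
Lemma scalD : {morph scal : x y / x + y}. Proof. by move=> x y; rewrite /scal !polyCD. Qed.
Lemma scal1 : scal 1 = 1. Proof. by rewrite /scal !polyC1. Qed.
Lemma scalX n : {morph scal : c / c ^+ n}. Proof. by move=> c; rewrite /scal !polyC_exp. Qed.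
Lemma scal_nat n : scal n%:R = n%:R.
Proof. by rewrite /scal !polyC_natr. Qed.

Definition scal3 (g : {poly R}) : A := g%:P%:P.

Lemma scal3M : {morph scal3 : x y / x * y}. Proof. by move=> x y; rewrite /scal3 !polyCM. Qed.
Lemma scal3D : {morph scal3 : x y / x + y}. Proof. by move=> x y; rewrite /scal3 !polyCD. Qed.
Lemma scal3X n : {morph scal3 : c / c ^+ n}. Proof. by move=> c; rewrite /scal3 !polyC_exp. Qed.

Definition var (j : 'I_3) : A := [:: 'X; 'X%:P; scal3 'X]`_j.

(** Counts of candidates 1 and 2 are kept exact, since the tilt weights them; candidate 3 is not
    tilted, so its count is summed at once. *)
Definition tail_coef t k1 k2 (P : A) : R := psum R t P`_k1`_k2.

Lemma tail_coefD t k1 k2 : {morph tail_coef t k1 k2 : P Q / P + Q}.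
Proof.
move=> P Q; rewrite /tail_coef !coefD /psum -big_split.
by apply: eq_bigr => k _; rewrite coefD.
Qed.

Lemma tail_coef0 t k1 k2 : tail_coef t k1 k2 0 = 0.
Proof. by rewrite /tail_coef !coef0 /psum big1 // => k _; rewrite coef0. Qed.

Lemma tail_coef_sum t k1 k2 (I : Type) (r : seq I) (Q : pred I) (F : I -> A) :
  tail_coef t k1 k2 (\sum_(i <- r | Q i) F i) = \sum_(i <- r | Q i) tail_coef t k1 k2 (F i).
Proof. exact: (big_morph _ (tail_coefD t k1 k2) (tail_coef0 t k1 k2)). Qed.

Lemma tail_coefZ t k1 k2 c P : tail_coef t k1 k2 (scal c * P) = c * tail_coef t k1 k2 P.
Proof.
rewrite /tail_coef /scal !coefCM /psum mulr_sumr.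
by apply: eq_bigr => k _; rewrite coefCM.
Qed.

Lemma tail_coef_mono t k1 k2 (g : {poly R}) a b :
  tail_coef t k1 k2 (scal3 g * ('X ^+ a * 'X%:P ^+ b)) =
  psum R t g * ((a == k1) && (b == k2))%:R.
Proof.
have -> : scal3 g * ('X ^+ a * 'X%:P ^+ b) = (g%:P * 'X ^+ b)%:P * 'X ^+ a.
  by rewrite polyCM polyC_exp /scal3 mulrCA mulrC.
rewrite /tail_coef coefCM coefXn eq_sym; case: (a == k1) => /=; last first.
  by rewrite mulr0 coef0 mulr0 /psum big1 // => k _; rewrite coef0.
rewrite mulr1 coefCM coefXn eq_sym; case: (b == k2) => /=.
  by rewrite !mulr1.
by rewrite !mulr0 /psum big1 // => k _; rewrite coef0.
Qed.

Lemma psumXn t k : psum R t 'X^k = (k < t)%N%:R.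
Proof.
rewrite /psum; case: (ltnP k t) => kt.
  rewrite (bigD1 (Ordinal kt)) //= coefXn eqxx big1 ?addr0 // => i.
  by rewrite coefXn -val_eqE /= => /negbTE ->.
by rewrite big1 // => i _; rewrite coefXn ltn_eqF // (leq_trans (ltn_ord i)).
Qed.

Lemma sum_cf_votes t (N : 'I_3 -> nat) (w : R) :
  \sum_(k1 < t) \sum_(k2 < t) tail_coef t k1 k2 (scal w * \prod_j var j ^+ N j) =
  w * [forall j, (N j < t)%N]%:R.
Proof.
have -> : \prod_j var j ^+ N j = scal3 ('X ^+ N 2%R) * ('X ^+ N 0%R * 'X%:P ^+ N 1%R).
  rewrite !big_ord_recl big_ord0 mulr1 mulrA mulrC scal3X.
  have -> : lift ord0 (lift ord0 ord0) = 2 :> 'I_3 by apply/val_inj.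
  by have -> : lift ord0 ord0 = 1 :> 'I_3 by apply/val_inj.
under eq_bigr do under eq_bigr do rewrite tail_coefZ tail_coef_mono psumXn.
have -> : [forall j, (N j < t)%N] = [&& (N 0%R < t)%N, (N 1%R < t)%N & (N 2%R < t)%N].
  apply/forallP/and3P => [h|[h0 h1 h2] j]; first by split; apply: h.
  case: j => [[|[|[|j]]] jl] //.
  - by have -> : Ordinal jl = 0 by apply/val_inj.
  - by have -> : Ordinal jl = 1 by apply/val_inj.
  - by have -> : Ordinal jl = 2 by apply/val_inj.
case: (ltnP (N 0%R) t) => h0 /=; last first.
  rewrite mulr0 big1 // => k1 _; rewrite big1 // => k2 _.
  by rewrite gtn_eqF ?mulr0 // (leq_trans (ltn_ord k1)).
case: (ltnP (N 1%R) t) => h1 /=; last first.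
  rewrite mulr0 big1 // => k1 _; rewrite big1 // => k2 _.
  by rewrite [N 1%R == _]gtn_eqF ?andbF ?mulr0 // (leq_trans (ltn_ord k2)).
rewrite (bigD1 (Ordinal h0)) //= [X in _ + X]big1 ?addr0 => [|k nk].
  rewrite (bigD1 (Ordinal h1)) //= [X in _ + X]big1 ?addr0 => [|k nk].
    by rewrite !eqxx mulr1.
  rewrite [N 1%R == _]eq_sym (_ : (_ == N 1%R) = false) ?andbF ?mulr0 //.
  by apply: contraNF nk => /eqP e; apply/eqP/val_inj.
rewrite big1 // => k2 _; rewrite eq_sym (_ : (_ == N 0%R) = false) ?mulr0 //.
by apply: contraNF nk => /eqP e; apply/eqP/val_inj.
Qed.

End NestedCoefficients.

Section CondorcetMass.
Variables (R : realType) (rho : R).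
Notation A := {poly {poly {poly R}}}.
Let W (r : 'S_4) := mallows rho 1 r.

Lemma CW4_iff n (v : {ffun 'I_n -> 'S_4}) : (0 < n)%N ->
  [forall j : 'I_3, (n < 2 * #|[set i : 'I_n | (v i cand4 < v i (cand j))%N]|)%N] =
  [forall j : 'I_3, (#|[set i : 'I_n | j \in above4 (v i)]| < (max_minority n).+1)%N].
Proof.
move=> n0; apply: eq_forallb => j.
have -> : [set i | (v i cand4 < v i (cand j))%N] = ~: [set i | j \in above4 (v i)].
  apply/setP => i; rewrite !inE -leqNgt [RHS]leq_eqVlt.
  rewrite (_ : (_ == _ :> nat) = false) //; apply/eqP => /val_inj /perm_inj.
  by move/(congr1 val) => /=; have := ltn_ord j; lia.
have := cardsC [set i | j \in above4 (v i)]; rewrite card_ord.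
by rewrite /max_minority; move: #|_| #|_| n0 => x y; lia.
Qed.

(** By independence, expanding the n-th power of the one-voter generating polynomial enumerates the
    voting profiles with their probabilities. *)
Lemma probCW4_coef n : (0 < n)%N ->
  probCW4 rho n = \sum_(k1 < (max_minority n).+1) \sum_(k2 < (max_minority n).+1)
    tail_coef R (max_minority n).+1 k1 k2
     ((\sum_(r : 'S_4) scal R (W r) * \prod_(j in above4 r) var R j) ^+ n).
Proof.
move=> n0; rewrite -[n in _ ^+ n]card_ord -prodr_const bigA_distr_bigA /=.
under [RHS]eq_bigr do under eq_bigr do rewrite tail_coef_sum.
under [RHS]eq_bigr do rewrite exchange_big /=.
rewrite exchange_big /=; apply: eq_bigr => v _.
rewrite CW4_iff //.
rewrite -(sum_cf_votes R _ (fun j => #|[set i : 'I_n | j \in above4 (v i)]|)).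
apply: eq_bigr => k1 _; apply: eq_bigr => k2 _; congr tail_coef.
rewrite [RHS]big_split; congr (_ * _).
  exact: (big_morph _ (scalM R) (scal1 R)).
under [RHS]eq_bigr do rewrite big_mkcond /=.
rewrite exchange_big /=; apply: eq_bigr => j _.
by rewrite -big_mkcond /= -prodr_const; apply: eq_bigl => i; rewrite inE.
Qed.
End CondorcetMass.

(** * Exponential tilting *)

Section Tilt.
Variables (R : realType) (rho : R).
Hypothesis hrho : 0 < rho.
Notation A := {poly {poly {poly R}}}.

Definition mallows_q : R := expR (- rho).
Definition ksum : R := \sum_(s : 'S_4) mallows_q ^+ kendall s 1.

(* Under the tilted law, tilt_p is the probability that exactly one of 1 and 2
   is above 4, and tilt_th the conditional probability, given the opposite,
   that 4 lies between 3 and the pair 1, 2. *)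
Definition tilt_p : R := 2 * mallows_q / (1 + 4 * mallows_q + mallows_q ^+ 2).
Definition tilt_th : R := mallows_q / (1 + mallows_q) ^+ 2.
Definition tilt_P : R := 2 * (mallows_q ^+ 3 * (1 + mallows_q) * (1 + 4 * mallows_q + mallows_q ^+ 2)) / ksum.

Lemma mallows_q_gt0 : 0 < mallows_q. Proof. exact: expR_gt0. Qed.
Lemma mallows_q_lt1 : mallows_q < 1. Proof. by rewrite /mallows_q -expR0 ltr_expR oppr_lt0. Qed.

Lemma ksum_gt0 : 0 < ksum.
Proof.
rewrite /ksum (bigD1 (1%g : 'S_4)) //= ltr_pwDl ?exprn_gt0 ?mallows_q_gt0 //.
by apply: sumr_ge0 => s _; rewrite exprn_ge0 // ltW // mallows_q_gt0.
Qed.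

Lemma den_gt0 : 0 < 1 + 4 * mallows_q + mallows_q ^+ 2.
Proof. have := mallows_q_gt0; have := sqr_ge0 mallows_q; lra. Qed.

Lemma tilt_P_gt0 : 0 < tilt_P.
Proof.
have q0 := mallows_q_gt0; have d0 := den_gt0; have k0 := ksum_gt0.
by rewrite /tilt_P divr_gt0 // !mulr_gt0 ?exprn_gt0 // addr_gt0.
Qed.

Lemma tilt_p_itv : 0 < tilt_p < 1.
Proof.
have q0 := mallows_q_gt0; have d0 := den_gt0.
rewrite /tilt_p divr_gt0 ?mulr_gt0 //= ltr_pdivrMr // mul1r.
by have := sqr_ge0 mallows_q; lra.
Qed.

Lemma tilt_th_itv : 0 <= tilt_th <= 1.
Proof.
have q0 := mallows_q_gt0; rewrite /tilt_th divr_ge0 ?sqr_ge0 ?(ltW q0) //=.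
rewrite ler_pdivrMr ?exprn_gt0 ?addr_gt0 // mul1r.
by have := sqr_ge0 mallows_q; lra.
Qed.

Lemma mallowsE (r : 'S_4) : mallows rho 1 r = ksum^-1 * mallows_q ^+ kendall r 1.
Proof.
have e (s : 'S_4) : expR (- rho * (kendall s 1)%:R) = mallows_q ^+ kendall s 1.
  by rewrite /mallows_q -expRM_natr.
by rewrite /mallows e mulrC; under eq_bigr do rewrite e.
Qed.

Definition gen_poly (B : comNzRingType) (q x0 x1 x2 : B) : B :=
  (1 + q) * ((1 + q + q ^+ 2) * (q ^+ 3 + x0 * x1 * x2) +
    q ^+ 2 * x0 + q ^+ 3 * x1 + q ^+ 4 * x2 +
    q * x0 * x1 + q ^+ 2 * x0 * x2 + q ^+ 3 * x1 * x2).

Lemma PpolyE (x : 'rV[R]_3) :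
  Ppoly rho x = ksum^-1 * gen_poly R mallows_q (x 0 0) (x 0 1) (x 0 2).
Proof.
rewrite /gen_poly -(sum_kendall_above R mallows_q (fun j => x 0 j)) mulr_sumr.
rewrite /Ppoly (partition_big (above4) predT) //=; apply: eq_bigr => X _.
rewrite /pX mulr_suml; apply: eq_bigr => r /eqP <-.
by rewrite mallowsE mulrA.
Qed.

Definition y1 : A := scal R (mallows_q ^- 2) * 'X.
Definition y2 : A := scal R (mallows_q^-1) * 'X%:P.

Lemma scal3_linp a b : scal3 R (linp R a b) = scal R a + scal R b * scal3 R 'X.
Proof. by rewrite /linp scal3D scal3M. Qed.

Lemma sum_votes_tilt :
  \sum_(r : 'S_4) scal R (mallows rho 1 r) * \prod_(j in above4 r) var R j =
  scal R tilt_P * (scal R (1 - tilt_p) * (scal R (1 / 2) *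
       (scal3 R (linp R (1 - tilt_th) tilt_th) + y1 * y2 * scal3 R (linp R tilt_th (1 - tilt_th)))) +
     scal R tilt_p * (scal R (1 / 2) * (y2 + y1) * scal3 R (linp R (1 / 2) (1 / 2)))).
Proof.
have q0 := lt0r_neq0 mallows_q_gt0; have d0 := lt0r_neq0 den_gt0; have k0 := lt0r_neq0 ksum_gt0.
have q10 : 1 + mallows_q != 0 by rewrite lt0r_neq0 // addr_gt0 // mallows_q_gt0.
under eq_bigr do rewrite mallowsE scalM scalX -mulrA.
rewrite -mulr_sumr sum_kendall_above !scal3_linp.
pose c : R := ksum^-1 * (mallows_q ^+ 3 * (1 + mallows_q)).
have ex0 : var R 0 = scal R mallows_q ^+ 2 * y1.
  by rewrite /y1 -scalX mulrA -scalM divff ?expf_neq0 // scal1 mul1r.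
have ex1 : var R 1 = scal R mallows_q * y2.
  by rewrite /y2 mulrA -scalM divff // scal1 mul1r.
rewrite ex0 ex1; apply: (tilt_identity _ _ _ _ _ _ _ _ _ _ _ _ (scal R c)).
- by rewrite /c !(scalM, scalD, scalX) scal1.
- rewrite -!scalM; congr scal; rewrite /c /tilt_P /tilt_p.
  by move: ksum k0 => Z Z0; move: mallows_q q0 d0 q10 => q q0 d0 q10; field; rewrite d0 Z0.
- rewrite -(scal1 R) -!(scalM, scalD, scalX); congr scal; rewrite /c /tilt_P /tilt_p /tilt_th.
  by move: ksum k0 => Z Z0; move: mallows_q q0 d0 q10 => q q0 d0 q10; field; rewrite d0 Z0 q10.
- rewrite -!scalM; congr scal; rewrite /c /tilt_P /tilt_p /tilt_th.
  by move: ksum k0 => Z Z0; move: mallows_q q0 d0 q10 => q q0 d0 q10; field; rewrite d0 Z0 q10.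
Qed.

(** Change of measure: the powers of q depend only on the two prescribed counts, so they leave the
    sum and a tilted probability remains. *)
Lemma tail_coef_tilt t n k1 k2 :
  tail_coef R t k1 k2 ((\sum_(r : 'S_4) scal R (mallows rho 1 r) * \prod_(j in above4 r) var R j) ^+ n) =
  tilt_P ^+ n * ((mallows_q ^- 2) ^+ k1 * (mallows_q^-1) ^+ k2 * binE R tilt_p n (cell R tilt_th n k1 k2 t)).
Proof.
rewrite sum_votes_tilt exprMn -scalX tail_coefZ; congr (_ * _).
rewrite mixture_expand tail_coef_sum /binE mulr_sumr; apply: eq_bigr => d _.
rewrite /cell tail_coef_sum !mulr_sumr; apply: eq_bigr => a _.
rewrite tail_coef_sum !mulr_sumr; apply: eq_bigr => b _.
pose c : R := 'C(n, d)%:R * tilt_p ^+ d * (1 - tilt_p) ^+ (n - d) *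
  ('C(n - d, a)%:R * (1 / 2) ^+ (n - d)) * ('C(d, b)%:R * (1 / 2) ^+ d).
pose w : R := (mallows_q ^- 2) ^+ (a + b) * (mallows_q^-1) ^+ (a + (d - b)).
transitivity (tail_coef R t k1 k2 (scal R (c * w) *
    (scal3 R (third R tilt_th d a (n - d - a)) * ('X ^+ (a + b) * 'X%:P ^+ (a + (d - b)))))).
  congr tail_coef; rewrite scalM [RHS]mulrACA; congr (_ * _ * _).
  - by rewrite /c; move: (1 / 2) tilt_p => h p; rewrite !scalM !scalX !scal_nat.
  - by rewrite /third !scal3M !scal3X.
  - by rewrite /w /y1 /y2 !exprMn scalM !scalX mulrACA.
rewrite tail_coefZ tail_coef_mono /c /w.
case: (boolP (_ && _)) => [/andP[/eqP <- /eqP <-]|_]; last by rewrite !mulr0.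
rewrite /fairbin !div1r !mulr1 -!exprVn.
set u := psum _ _ _; move: u (_ ^+ (a + b)) (_ ^+ (a + (d - b))) => u v x.
by ring.
Qed.
End Tilt.

(** * Asymptotics of the election probability *)

Section Asymptotics.
Variable R : realType.
Local Open Scope classical_set_scope.
Local Open Scope ring_scope.

(** [tannery] is iterated: the inner sum over j supplies both the limit and the bound C / (1 - z2)
    for the outer one. *)
Lemma mass_sum_cvg (p th z1 z2 : R) : 0 < p < 1 -> 0 <= th <= 1 ->
  0 <= z1 < 1 -> 0 <= z2 < 1 ->
  (fun n => n%:R * \sum_(i < (max_minority n).+1) \sum_(j < (max_minority n).+1)
     z1 ^+ i * z2 ^+ j * mass R p th n i j) @ \oo -->
  (2 * pi * bin_sd R p)^-1 / (1 - z2) / (1 - z1).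
Proof.
move=> p01 th01 z101 z201.
have Moo : (fun n => (max_minority n).+1) @ \oo --> \oo.
  move=> P [N _ NP]; exists (2 * N)%N => // n /= nN; apply: NP => /=.
  by move: nN; rewrite /max_minority; clear; lia.
pose C := Num.sqrt (bin_sd R p ^+ 4)^-1 + (bin_sd R p)^-1.
have s0 : 0 < bin_sd R p by exact: bin_sd_gt0.
have C0 : 0 <= C by rewrite addr_ge0 ?sqrtr_ge0 // invr_ge0 ltW.
have fC n i j : `|n%:R * mass R p th n i j| <= C.
  case: n => [|n]; first by rewrite mul0r normr0.
  by rewrite ger0_norm ?mass_ge0 ?mass_le.
have -> : (fun n => n%:R * \sum_(i < (max_minority n).+1) \sum_(j < (max_minority n).+1)
     z1 ^+ i * z2 ^+ j * mass R p th n i j) =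
  (fun n => \sum_(i < (max_minority n).+1) z1 ^+ i * \sum_(j < (max_minority n).+1)
     z2 ^+ j * (n%:R * mass R p th n i j)).
  apply/funext => n; rewrite mulr_sumr; apply: eq_bigr => i _.
  by rewrite !mulr_sumr; apply: eq_bigr => j _; ring.
pose g n i := \sum_(j < (max_minority n).+1) z2 ^+ j * (n%:R * mass R p th n i j).
apply: (tannery R z1 (C / (1 - z2)) _ g (fun n => (max_minority n).+1)) => //.
- move=> n k; apply: le_trans (ler_norm_sum _ _ _) _.
  apply: (@le_trans _ _ (\sum_(j < (max_minority n).+1) z2 ^+ j * C)).
    apply: ler_sum => j _; case/andP: z201 => z20 _.
    by rewrite normrM ger0_norm ?exprn_ge0 // ler_wpM2l ?exprn_ge0.
  by rewrite -mulr_suml mulrC ler_wpM2l // geom_sum_le.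
- move=> i; apply: (tannery R z2 C _ (fun n j => n%:R * mass R p th n i j) (fun n => (max_minority n).+1)) => //.
  by move=> j; apply: mass_cvg.
Qed.

Lemma probCW4_mass (rho : R) n : 0 < rho -> (0 < n)%N ->
  probCW4 rho n = tilt_P R rho ^+ n /
    ((mallows_q R rho ^+ 2) ^+ max_minority n * mallows_q R rho ^+ max_minority n) *
  \sum_(i < (max_minority n).+1) \sum_(j < (max_minority n).+1)
    (mallows_q R rho ^+ 2) ^+ i * mallows_q R rho ^+ j * mass R (tilt_p R rho) (tilt_th R rho) n i j.
Proof.
move=> hrho n0; rewrite probCW4_coef //.
under eq_bigr do under eq_bigr do rewrite tail_coef_tilt //.
(* The negative powers of q grow with the counts; counting down from the maximum turns them into
   decaying geometric weights. *)
rewrite (reindex_inj rev_ord_inj) mulr_sumr; apply: eq_bigr => i _.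
rewrite (reindex_inj rev_ord_inj) mulr_sumr; apply: eq_bigr => j _.
have q0 := lt0r_neq0 (mallows_q_gt0 R rho).
have inv_exp (x : R) (k : 'I_(max_minority n).+1) : x != 0 ->
    x^-1 ^+ (max_minority n - k) = x ^+ k / x ^+ max_minority n.
  move=> x0; have km : (k <= max_minority n)%N by rewrite -ltnS.
  have -> : x ^+ max_minority n = x ^+ (max_minority n - k) * x ^+ k by rewrite -exprD subnK.
  by rewrite exprVn; field; rewrite !expf_neq0.
rewrite /= !subSS !inv_exp ?expf_neq0 // /mass.
move: (binE _ _ _ _) => b; field; rewrite ?expf_neq0 //.
Qed.
End Asymptotics.

(** * The Hessian of K *)

Section Hessian.
Variables (R : realType) (rho : R).

Lemma derive_along (f : 'rV[R]_3 -> R) (t v : 'rV[R]_3) (g : R -> R) (d : R) :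
  (forall h, f (h *: v + t) = g h) -> is_derive (0 : R) (1 : R) g d -> derive f t v = d.
Proof.
move=> fg dg; rewrite -[RHS](@derive_val _ _ _ _ _ _ _ dg).
have E : (fun h : R => h^-1 *: ((f \o shift t) (h *: v) - f t)) =
    (fun h : R => h^-1 *: ((g \o shift 0) (h *: (1 : R)) - g 0)).
  apply/funext => h /=; rewrite fg -[X in f X]add0r -[X in f (X + _)](scale0r v) fg.
  by rewrite addr0 /GRing.scale /= mulr1.
by rewrite /derive E.
Qed.

(** P is affine in each variable, so this is P with the operators x_j d/dx_j applied for j in Y. *)
Definition part_above (Y : {set 'I_3}) (x : 'rV[R]_3) : R :=
  \sum_(X : {set 'I_3} | Y \subset X) pX rho X * \prod_(j in X) x 0 j.

Definition expv (t : 'rV[R]_3) : 'rV[R]_3 := \row_j expR (t 0 j).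

Definition scalev (i : 'I_3) (c : R) (x : 'rV[R]_3) : 'rV[R]_3 :=
  \row_j ((if j == i then c else 1) * x 0 j).

Lemma part_above0 x : part_above finset.set0 x = Ppoly rho x.
Proof. by apply: eq_bigl => X; rewrite finset.sub0set. Qed.

Lemma part_above_scalev Y i c x :
  part_above Y (scalev i c x) = (part_above Y x - part_above (i |: Y) x) + c * part_above (i |: Y) x.
Proof.
pose F (X : {set 'I_3}) := pX rho X * \prod_(j in X) x 0 j.
have e (X : {set 'I_3}) : pX rho X * \prod_(j in X) (scalev i c x) 0 j =
    (if i \in X then c else 1) * F X.
  rewrite mulrCA; congr (_ * _).
  under eq_bigr do rewrite mxE.
  rewrite big_split /=; congr (_ * _).
  case: (boolP (i \in X)) => iX.
    by rewrite (bigD1 i) //= eqxx big1 ?mulr1 // => j /andP[_ /negbTE ->].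
  rewrite big1 // => j jX; rewrite (_ : (j == i) = false) //.
  by apply: contraNF iX => /eqP <-.
have eU : part_above (i |: Y) x = \sum_(X : {set 'I_3} | (Y \subset X) && (i \in X)) F X.
  by apply: eq_bigl => X; rewrite finset.subUset finset.sub1set andbC.
have eY : part_above Y x = part_above (i |: Y) x +
    \sum_(X : {set 'I_3} | (Y \subset X) && (i \notin X)) F X.
  by rewrite eU /part_above (bigID (fun X : {set 'I_3} => i \in X)).
rewrite eY [X in X - _]addrC addrK eU /part_above (eq_bigr _ (fun X _ => e X)).
rewrite (bigID (fun X : {set 'I_3} => i \in X)) /= addrC mulr_sumr.
congr (_ + _); apply: eq_bigr => X /andP[_]; last by move=> ->.
by move=> /negbTE ->; rewrite mul1r.
Qed.

Lemma expv_shift i h t : expv (h *: delta_mx 0 i + t) = scalev i (expR h) (expv t).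
Proof.
apply/rowP => j; rewrite !mxE eqxx /= expRD; congr (_ * _).
by case: (j == i); rewrite ?mulr1 // mulr0 expR0.
Qed.

Lemma part_above0_gt0 t : 0 < part_above finset.set0 (expv t).
Proof.
rewrite part_above0 PpolyE /gen_poly mulr_gt0 ?invr_gt0 ?ksum_gt0 //.
by rewrite !(mulr_gt0, addr_gt0) ?exprn_gt0 ?mallows_q_gt0 ?mxE ?expR_gt0.
Qed.

Lemma is_derive_affine_expR (a b : R) :
  is_derive (0 : R) (1 : R) (fun h : R => a + expR h * b) b.
Proof.
have -> : (fun h : R => a + expR h * b) = cst a + b \*: expR.
  by apply/funext => h; rewrite mulrC.
by apply: is_derive_eq; rewrite add0r expR0 /GRing.scale /= mulr1.
Qed.

Lemma derive_Kfun t i :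
  derive (Kfun rho) t (delta_mx 0 i) = part_above [set i] (expv t) / part_above finset.set0 (expv t).
Proof.
pose a := part_above finset.set0 (expv t) - part_above [set i] (expv t); set b := part_above [set i] _.
have ab : a + b = part_above finset.set0 (expv t) by rewrite subrK.
have ab0 : 0 < a + b by rewrite ab part_above0_gt0.
apply: (derive_along _ _ _ (fun h => ln (a + expR h * b))).
  by move=> h; rewrite /Kfun -/(expv _) -part_above0 expv_shift part_above_scalev finset.setU0.
have d1 := is_derive_affine_expR a b.
rewrite -ab mulrC.
have pos : 0 < a + expR 0 * b by rewrite expR0 mul1r.
have := @is_derive1_comp R (@ln R) (fun h => a + expR h * b) 0 _ _ (is_derive1_ln pos) d1.
by rewrite expR0 mul1r.
Qed.

(** The Hessian of a log generating function: the covariance of the indicators that i and j are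
    above 4 under the tilted law. *)
Lemma hessK_part_above tau i j : hessK rho tau i j =
  part_above (j |: [set i]) (expv tau) / part_above finset.set0 (expv tau) -
  part_above [set i] (expv tau) * part_above [set j] (expv tau) / part_above finset.set0 (expv tau) ^+ 2.
Proof.
rewrite mxE (_ : (fun t => _) = (fun t => part_above [set i] (expv t) / part_above finset.set0 (expv t))).
2: by apply/funext => t; rewrite derive_Kfun.
set P := part_above finset.set0 _; have P0 : P != 0 by rewrite lt0r_neq0 // part_above0_gt0.
set ai := part_above [set i] _; set aj := part_above [set j] _; set aij := part_above (_ |: _) _.
apply: (derive_along _ _ _ (fun h => ((ai - aij) + expR h * aij) / ((P - aj) + expR h * aj))).
  by move=> h; rewrite expv_shift !part_above_scalev finset.setU0.
pose u (h : R) := ai - aij + expR h * aij; pose v (h : R) := P - aj + expR h * aj.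
have v0 : v 0 = P by rewrite /v expR0 mul1r subrK.
have u0 : u 0 = ai by rewrite /u expR0 mul1r subrK.
have dV : is_derive (0 : R) (1 : R) (fun h => (v h)^-1) (- (v 0) ^- 2 * aj).
  have vn0 : v 0 != 0 by rewrite v0.
  have dv : is_derive (0 : R) (1 : R) v aj by exact: is_derive_affine_expR.
  by apply: is_derive_eq.
have du : is_derive (0 : R) (1 : R) u aij by exact: is_derive_affine_expR.
have := @is_deriveM _ _ u (fun h => (v h)^-1) 0 1 _ _ du dV.
rewrite v0 u0 => h; apply: (@is_derive_eq _ _ _ _ _ _ _ _ h).
by rewrite /GRing.scale /=; field.
Qed.
End Hessian.

(** * The Hessian at the tilting point *)

Section TiltedHessian.
Variables (R : realType) (rho : R).
Hypothesis hrho : 0 < rho.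
Let q := mallows_q R rho.
Let p := tilt_p R rho.

Definition zetav : 'rV[R]_3 := \row_(j < 3) [:: expR (- (2 * rho)); expR (- rho); 1]`_j.
Definition tauv : 'rV[R]_3 := \row_(j < 3) [:: - (2 * rho); - rho; 0]`_j.

Lemma expR_sqr : expR (- (2 * rho)) = q ^+ 2.
Proof. by rewrite /q /mallows_q -expRM_natl; congr expR; ring. Qed.

Lemma expv_tau : expv R tauv = zetav.
Proof.
by apply/rowP => -[[|[|[|k]]] k3] //; rewrite !mxE //= expR0.
Qed.

Lemma zetavE : (zetav 0 0 = q ^+ 2) * (zetav 0 1 = q) * (zetav 0 2 = 1).
Proof. by rewrite !mxE /= expR_sqr. Qed.

Lemma Ppoly_zeta : Ppoly rho zetav = tilt_P R rho.
Proof.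
rewrite PpolyE !zetavE /gen_poly /tilt_P -/q.
have := lt0r_neq0 (ksum_gt0 R rho); move: (ksum R rho) => Z Z0.
by field.
Qed.

(** Setting x_i = 0 removes the sets containing i, so every part is a difference of values of the
    explicit polynomial P. *)
Lemma part_above_scale0 Y i x : part_above R rho (i |: Y) x = part_above R rho Y x - part_above R rho Y (scalev R i 0 x).
Proof. by rewrite part_above_scalev mul0r addr0 opprB addrC subrK. Qed.

(** At zeta each candidate is above 4 with tilted probability 1/2: zeta is the saddle point for all
    three majority thresholds. *)
Lemma part_above1 i : part_above R rho [set i] zetav = tilt_P R rho / 2.
Proof.
rewrite -[[set i]]finset.setU0 part_above_scale0 !part_above0 Ppoly_zeta PpolyE !mxE.
rewrite expR_sqr -/(mallows_q R rho) -/q /gen_poly /tilt_P -/q.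
have := lt0r_neq0 (ksum_gt0 R rho); move: (ksum R rho) => Z Z0.
by case: i => [[|[|[|k]]] k3] //=; field.
Qed.

Lemma part_above2 i j : i != j -> part_above R rho (j |: [set i]) zetav = tilt_P R rho * (1 - p) / 2.
Proof.
rewrite -[[set i]]finset.setU0 !part_above_scale0 !part_above0 Ppoly_zeta !PpolyE !mxE.
rewrite expR_sqr -/(mallows_q R rho) -/q /gen_poly /tilt_P /p /tilt_p -/q.
have := lt0r_neq0 (ksum_gt0 R rho); move: (ksum R rho) => Z Z0.
have := lt0r_neq0 (den_gt0 R rho); rewrite -/q => d0.
by case: i => [[|[|[|k]]] k3] //=; case: j => [[|[|[|k']]] k3'] //= _; field; rewrite ?d0 ?Z0.
Qed.

Lemma hessK_tau i j : hessK rho tauv i j = if i == j then 1 / 4 else (1 - 2 * p) / 4.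
Proof.
have P0 := lt0r_neq0 (tilt_P_gt0 R rho).
rewrite hessK_part_above expv_tau !part_above1 part_above0 Ppoly_zeta.
case: eqVneq => [->|ij]; last first.
  by rewrite part_above2 //; move: (tilt_P R rho) P0 => P P0; field.
by rewrite finset.setUid part_above1; move: (tilt_P R rho) P0 => P P0; field.
Qed.

Lemma det_mx2 (A : 'M[R]_2) : \det A = A 0 0 * A 1 1 - A 0 1 * A 1 0.
Proof.
rewrite (expand_det_row _ 0) !big_ord_recl big_ord0 addr0 /cofactor !det_mx11 !mxE /=.
have -> : lift 0 0 = 1 :> 'I_2 by apply/val_inj.
have -> : lift 1 0 = 0 :> 'I_2 by apply/val_inj.
by rewrite expr0 expr1; ring.
Qed.

Lemma hessK_tauE : hessK rho tauv = \matrix_(i, j) (if i == j then 1 / 4 else (1 - 2 * p) / 4).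
Proof. by apply/matrixP => i j; rewrite hessK_tau mxE. Qed.

Lemma cofactor_hessK i : cofactor (hessK rho tauv) i i = p * (1 - p) / 4.
Proof.
rewrite hessK_tauE /cofactor det_mx2 !mxE !(inj_eq (@lift_inj _ i)) /=.
by rewrite -signr_odd oddD addbb expr0; field.
Qed.

Lemma det_hessK : \det (hessK rho tauv) = p ^+ 2 * (3 - 4 * p) / 16.
Proof.
rewrite (expand_det_row _ 0) !big_ord_recl big_ord0 cofactor_hessK hessK_tauE.
by rewrite /cofactor !det_mx2 !mxE /= !add0n !expr1 expr2; field.
Qed.

(** Cramer's rule cancels the determinant and leaves the covariance minor of candidates 1 and 2. *)
Lemma det_inv_hessK : \det (hessK rho tauv) * (invmx (hessK rho tauv)) 2 2 = p * (1 - p) / 4.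
Proof.
(* [invmx] is a true inverse only for a unit determinant; here this amounts to p < 3/4. *)
have D0 : \det (hessK rho tauv) != 0.
  rewrite det_hessK; have /andP[p0 p1] := tilt_p_itv R rho.
  apply: lt0r_neq0; rewrite divr_gt0 // mulr_gt0 ?exprn_gt0 // subr_gt0.
  have q0 := mallows_q_gt0 R rho; have q2 := sqr_ge0 (mallows_q R rho).
  by rewrite /p /tilt_p mulrA ltr_pdivrMr ?den_gt0 //; lra.
by rewrite /invmx unitmxE unitfE D0 !mxE mulrA divff // mul1r cofactor_hessK.
Qed.

Lemma sqrt_det_inv_hessK :
  Num.sqrt (\det (hessK rho tauv) * (invmx (hessK rho tauv)) 2 2) = bin_sd R p / 2.
Proof.
have /andP[p0 p1] := tilt_p_itv R rho.
rewrite det_inv_hessK sqrtrM; last by rewrite mulr_ge0 ?subr_ge0 ?ltW.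
rewrite -/(bin_sd R p); congr (_ * _).
by rewrite (_ : 4^-1 = 2^-1 ^+ 2) ?sqrtr_sqr ?ger0_norm ?invr_ge0 //; field.
Qed.
End TiltedHessian.

Theorem theorem7 (R : realType) (rho : R) (hrho : 0 < rho) :
  let zeta : 'rV[R]_3 := \row_(j < 3) [:: expR (- (2 * rho)); expR (- rho); 1]`_j in
  let tau : 'rV[R]_3 := \row_(j < 3) [:: - (2 * rho); - rho; 0]`_j in
  let S : {set 'I_3} := [set (0 : 'I_3); (1 : 'I_3)] in
  let H := hessK rho tau in
  let M33 := (invmx H) 2 2 in
  (fun n : nat => probCW4 rho n) ~_(\oo%classic)
  (fun n : nat =>
     Ppoly rho zeta ^+ n /
       (\prod_(j in S) ((1 - zeta ord0 j) * zeta ord0 j ^+ (uphalf n - 1)%N))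
     * (4 * pi * n%:R * Num.sqrt (\det H * M33))^-1).
Proof.
move=> zeta tau S H M33; rewrite /M33 /H.
have -> : Num.sqrt (\det (hessK rho tau) * (invmx (hessK rho tau)) 2 2) =
  bin_sd R (tilt_p R rho) / 2 by exact: sqrt_det_inv_hessK.
have -> : Ppoly rho zeta = tilt_P R rho by exact: Ppoly_zeta.
pose q := mallows_q R rho; pose l : R := (2 * pi * bin_sd R (tilt_p R rho))^-1 / (1 - q) / (1 - q ^+ 2).
have q0 : 0 < q := mallows_q_gt0 R rho; have q1 : q < 1 := mallows_q_lt1 R rho hrho.
have q21 : q ^+ 2 < 1 by rewrite exprn_ilt1 // ltW.
have pS k : \prod_(j in S) ((1 - zeta ord0 j) * zeta ord0 j ^+ k) =
    (1 - q ^+ 2) * (1 - q) * ((q ^+ 2) ^+ k * q ^+ k).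
  rewrite finset.big_setU1 ?finset.inE //= finset.big_set1.
  have [[e0 e1] _] := zetavE R rho.
  have -> : zeta ord0 0 = q ^+ 2 by exact: e0.
  have -> : zeta ord0 1 = q by exact: e1.
  by ring.
have s0 : 0 < bin_sd R (tilt_p R rho) by apply: bin_sd_gt0; exact: tilt_p_itv.
have l0 : 0 < l by rewrite !divr_gt0 ?invr_gt0 ?mulr_gt0 ?pi_gt0 ?subr_gt0.
have := mass_sum_cvg R (tilt_p R rho) (tilt_th R rho) (q ^+ 2) q (tilt_p_itv R rho) (tilt_th_itv R rho) _ _.
set F := (fun n => n%:R * _); move=> Fl.
have {}Fl : (F @ \oo --> l)%classic.
  by apply: Fl; rewrite ?sqr_ge0 ?(ltW q0).
apply/eqaddoP => e e0.
(* Both sides share the factor X / Y / n, so relative error e in the claim is absolute error e * l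
   in the convergence to l. *)
move/cvgrPdist_le: Fl => /(_ (e * l) (mulr_gt0 e0 l0)) [N _ FN].
exists N.+1 => // n /= nN; have n0 : (0 < n)%N by apply: leq_ltn_trans nN.
have {FN} := FN n (ltnW nN).
rewrite !fctE pS probCW4_mass // -/q -/(max_minority n).
set X := tilt_P R rho ^+ n; set Y := (_ * q ^+ _).
rewrite /F; set T := \sum_(i < _) _ => FN.
have Y0 : 0 < Y by rewrite mulr_gt0 ?exprn_gt0.
have X0 : 0 < X by rewrite exprn_gt0 ?tilt_P_gt0.
have nn0 : 0 < n%:R :> R by rewrite ltr0n.
have pi0 := pi_gt0 R.
have -> : X / ((1 - q ^+ 2) * (1 - q) * Y) * (4 * pi * n%:R * (bin_sd R (tilt_p R rho) / 2))^-1 =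
  X / Y / n%:R * l.
  have a0 : 1 - q != 0 by rewrite subr_eq0 eq_sym lt_eqF.
  have b0 : 1 - q ^+ 2 != 0 by rewrite subr_eq0 eq_sym lt_eqF.
  rewrite /l; move: (lt0r_neq0 pi0) (lt0r_neq0 s0) (lt0r_neq0 Y0) (lt0r_neq0 nn0) a0 b0.
  move: (pi : R) (bin_sd R (tilt_p R rho)) (n%:R : R) (1 - q) (1 - q ^+ 2).
  move=> P s m a b P0 s1 y0 m0 a0 b0; field.
  by rewrite P0 s1 y0 m0 a0 b0.
have -> : X / Y * T = X / Y / n%:R * (n%:R * T) by field; rewrite !lt0r_neq0.
rewrite -mulrBr normrM [X in e * X]normrM mulrCA ler_wpM2l // distrC.
by rewrite (gtr0_norm l0).
Qed.
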